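(* Let $n\ge 2$, let $\alpha=(\alpha_1,\dots,\alpha_n)\in\mathbb{C}^n\setminus\{0\}$ with $|\alpha_1|=\cdots=|\alpha_n|\neq 1$, and let $M_\alpha=(\mathbb{C}^n\setminus\{0\})/\sim$ be the Hopf manifold, where $(z_1,\dots,z_n)\sim(\alpha_1z_1,\dots,\alpha_nz_n)$. Let $\omega_H=\frac{\delta_{ij}}{r^2}\sqrt{-1}\,dz_i\wedge d\overline{z}_j$ with $r^2=\sum_{j=1}^n|z_j|^2$, a Hermitian metric on $M_\alpha$. Let $\omega_0=\omega_H+\sqrt{-1}\partial\overline{\partial}\psi$ be a Hermitian metric on $M_\alpha$, where $\psi$ is a smooth real function, and let $\omega(t)$ be the solution of the Chern-Ricci flow $$\frac{\partial}{\partial t}\omega=-\mathrm{Ric}(\omega),\qquad \omega|_{t=0}=\omega_0,$$ on $M_\alpha$ for $t\in[0,1/n)$. Then there exists a uniform constant $C$ (independent of $t$) such that $$\omega(t)\le C\,\omega_H\qquad\text{for } t\in[0,1/n).$$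
   Context: Summation over repeated indices is understood. A Hermitian metric $g$ is identified with its associated real positive $(1,1)$ form $\omega=\sqrt{-1}\,g_{i\overline{j}}\,dz_i\wedge d\overline{z}_j$. The Chern-Ricci form of $\omega$ is $\mathrm{Ric}(\omega)=-\sqrt{-1}\partial\overline{\partial}\log\det g$ (locally). The inequality is an inequality of real $(1,1)$ forms (i.e. of Hermitian matrices at each point). The Chern-Ricci flow starting at such $\omega_0$ has a unique smooth solution on $[0,1/n)$. *)

(* Defs.v *)
From HB Require Import structures.
From mathcomp Require Import all_boot all_order all_algebra.
From mathcomp Require Import all_classical all_reals all_analysis.
From mathcomp Require Import complex.

Set Implicit Arguments.
Unset Strict Implicit.
Unset Printing Implicit Defensive.

Import Order.TTheory GRing.Theory Num.Theory.
Import numFieldNormedType.Exports.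

Local Open Scope classical_set_scope.
Local Open Scope ring_scope.
Local Open Scope complex_scope.

Section Smooth.
Context {R : realType} {V : normedModType R}.

Definition iter_derive (f : V -> R) (vs : seq V) : V -> R :=
  foldl (fun h v => fun x => 'D_v h x) f vs.

(* C^oo on an open subset U of a finite-dimensional V: all iterated
   directional derivatives exist and are continuous at the points of U. *)
Definition smooth_open (U : set V) (f : V -> R) : Prop :=
  forall (vs : seq V) (x : V), U x ->
    {for x, continuous (iter_derive f vs)} /\
    forall v : V, derivable (iter_derive f vs) x v.

(* Smoothness on an arbitrary subset, in the sense of manifolds with boundary:
   near each point of A, f agrees on A with a smooth function defined on an
   open neighbourhood. It is used for A = [0, T[ * (C^n \ 0). *)
Definition smooth_on (A : set V) (f : V -> R) : Prop :=
  forall x : V, A x -> exists (U : set V) (F : V -> R),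
    [/\ open U, U x, smooth_open U F & forall y : V, A y -> U y -> F y = f y].

End Smooth.

(* f'(t) = l, for the function f restricted to the set I (one-sided at an
   endpoint of I). *)
Definition has_derive_within {R : realType} (I : set R) (f : R -> R)
    (t l : R) : Prop :=
  h^-1 * (f (t + h) - f t) @[h --> within [set h | I (t + h)] 0^'] --> l.

(* C^n, as the real normed space R^n * R^n: (x, y) stands for x + i y. *)
Notation Cn R n := ('rV[R]_n * 'rV[R]_n)%type.

Section Wirtinger.
Context {R : realType} {n : nat}.
Implicit Types (z : Cn R n) (f : Cn R n -> R[i]).

Definition zcoord z (j : 'I_n) : R[i] := z.1 0 j +i* z.2 0 j.

Definition derive_C (v : Cn R n) f z : R[i] :=
  'D_v (fun w => complex.Re (f w)) z +i* 'D_v (fun w => complex.Im (f w)) z.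

Definition dx (j : 'I_n) f : Cn R n -> R[i] := derive_C (delta_mx 0 j, 0) f.
Definition dy (j : 'I_n) f : Cn R n -> R[i] := derive_C (0, delta_mx 0 j) f.

Definition d_z (j : 'I_n) f z : R[i] := 2^-1 * (dx j f z - 'i * dy j f z).
Definition d_zbar (j : 'I_n) f z : R[i] := 2^-1 * (dx j f z + 'i * dy j f z).

(* A (1,1) form i g_{i jbar} dz_i /\ dzbar_j on C^n \ 0 is represented by its
   matrix-valued coefficient function (g_{i jbar})_{i,j}; [ddbar u] represents
   i del delbar u. *)
Definition ddbar (u : Cn R n -> R) z : 'M[R[i]]_n :=
  \matrix_(i, j) d_z i (d_zbar j (fun w => (u w)%:C)) z.

End Wirtinger.

Section Positivity.
Context {R : realType} {n : nat}.

(* The order on R[i] is such that 0 < x and 0 <= x entail that x is real. *)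
Definition posdefmx (A : 'M[R[i]]_n) : Prop :=
  A \is hermsymmx /\
  forall v : 'rV[R[i]]_n, v != 0 ->
    0 < \sum_i \sum_j A i j * v 0 i * (v 0 j)^*%R.

Definition possemidefmx (A : 'M[R[i]]_n) : Prop :=
  A \is hermsymmx /\
  forall v : 'rV[R[i]]_n,
    0 <= \sum_i \sum_j A i j * v 0 i * (v 0 j)^*%R.

(* Inequality of real (1,1) forms at a point. *)
Definition form_le (A B : 'M[R[i]]_n) : Prop := possemidefmx (B - A).

End Positivity.

(* Functions and (1,1) forms on the Hopf manifold M_alpha are represented by
   their pullbacks to C^n \ 0, i.e. by the functions and forms there which are
   invariant under the deck transformation
   z |-> (alpha_1 z_1, ..., alpha_n z_n). Values at z = 0 are never used. *)
Section Hopf.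
Context {R : realType} {n : nat}.
Variable alpha : Cn R n.

Definition hopf_act (z : Cn R n) : Cn R n :=
  (\row_j complex.Re (zcoord alpha j * zcoord z j),
   \row_j complex.Im (zcoord alpha j * zcoord z j)).

Definition hopf_smooth_function (u : Cn R n -> R) : Prop :=
  smooth_open [set z : Cn R n | z != 0] u /\
  forall z : Cn R n, z != 0 -> u (hopf_act z) = u z.

Definition hopf_invariant_form (g : Cn R n -> 'M[R[i]]_n) : Prop :=
  forall z : Cn R n, z != 0 -> forall i j,
    zcoord alpha i * (zcoord alpha j)^*%R * g (hopf_act z) i j = g z i j.

Definition hopf_hermitian_metric (g : Cn R n -> 'M[R[i]]_n) : Prop :=
  [/\ forall i j, smooth_open [set z : Cn R n | z != 0]
        (fun z => complex.Re (g z i j)),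
      forall i j, smooth_open [set z : Cn R n | z != 0]
        (fun z => complex.Im (g z i j)),
      forall z : Cn R n, z != 0 -> posdefmx (g z)
    & hopf_invariant_form g].

End Hopf.

Section ChernRicci.
Context {R : realType} {n : nat}.

Definition omega_H (z : Cn R n) : 'M[R[i]]_n :=
  (\sum_j `|zcoord z j| ^+ 2)^-1%:M.

(* det g is a positive real number when g is positive definite. *)
Definition chern_ricci (g : Cn R n -> 'M[R[i]]_n) (z : Cn R n) : 'M[R[i]]_n :=
  - ddbar (fun w => ln (complex.Re (\det (g w)))) z.

(* omega is a smooth solution on M_alpha * [0, T[ of the Chern-Ricci flow
   starting at omega0. *)
Definition chern_ricci_flow (alpha : Cn R n) (T : R)
    (omega0 : Cn R n -> 'M[R[i]]_n) (omega : R -> Cn R n -> 'M[R[i]]_n) : Prop :=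
  let A : set (R * Cn R n) := [set p | 0 <= p.1 < T /\ p.2 != 0] in
  let I : set R := [set t | 0 <= t < T] in
  [/\ forall i j, smooth_on A (fun p => complex.Re (omega p.1 p.2 i j)) /\
                  smooth_on A (fun p => complex.Im (omega p.1 p.2 i j)),
      forall t, I t -> hopf_hermitian_metric alpha (omega t),
      forall t (z : Cn R n) i j, I t -> z != 0 ->
        has_derive_within I (fun s => complex.Re (omega s z i j)) t
          (complex.Re (- chern_ricci (omega t) z i j)) /\
        has_derive_within I (fun s => complex.Im (omega s z i j)) t
          (complex.Im (- chern_ricci (omega t) z i j))
    & forall z : Cn R n, z != 0 -> omega 0 z = omega0 z].

End ChernRicci.

(* Main.v *)
Require Import Defs.
From mathcomp Require Import all_boot all_order all_algebra.
From mathcomp Require Import all_classical all_reals all_analysis.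
From mathcomp Require Import complex perm.
From mathcomp Require Import ring lra.

Set Implicit Arguments.
Unset Strict Implicit.
Unset Printing Implicit Defensive.

Import Order.TTheory GRing.Theory Num.Theory.
Import numFieldNormedType.Exports.

Local Open Scope classical_set_scope.
Local Open Scope ring_scope.
Local Open Scope complex_scope.


(** Write [g] for the evolving metric, [r^2] for [nsq], and let
    [S = r^2 \sum_k g_(k kbar)] be the trace of [g] with respect to [omega_H].
    A positive definite matrix is bounded by its trace, so a uniform upper bound
    for [S] is enough, and the maximum principle provides it: at a point where
    [S(t, .)] is maximal and at least 2, [S] does not increase in time. Hence
    [S <= max(2, sup S(0, .))]. Maxima exist because [S] is invariant under the
    deck transformation and every orbit meets a fixed compact annulus
    ([to_annulus], [flow_trace_bound]).

    The flow equation gives [dS/dt = r^2 \sum_k d_k d_kbar log det g], so the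
    heart of the matter is that this sum is nonpositive at such a maximum
    ([ricci_trace_le0]). Two facts are combined.

    Torsion. The velocity of the flow is [ddbar] of a function, hence
    torsion-free because partial derivatives commute, and so is [ddbar psi].
    Therefore the torsion of [g] is at all times the explicit torsion of
    [omega_H] ([flow_torsion]), and the indices of first and second derivatives
    of [g] can be exchanged at the cost of explicit terms
    ([contracted_torsion], [contracted_curvature]).

    Concavity. For a positive definite matrix, [log det A <= tr A - n]. Let [E]
    be a frame that is unitary for [g] at the maximum point [z0], let
    [x_i = zbar_i / r^2] at [z0], and let [zeta] be the [k]-th coordinate centred
    at [z0]. Applying the inequality to [P g P^*] with
    [P = E (1 + zeta x e_k^T)], and using that [log |det P|^2] is pluriharmonic,
    bounds [d_k d_kbar log det g] at [z0] by [d_k d_kbar tr(P g P^* )]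
    ([ddbar_log_det_le]). The shear [x e_k^T] is the one for which the
    first-order terms complete the square of the gradient of [g], given that
    [S] is stationary at [z0]. After summation over [k] and exchange of indices
    the bound becomes the sum, over the vectors [e] of the frame, of
    [H(e) / r^2 + (S - 2) / r^2 (|<e, x>|^2 - |e|^2 / r^2)], where [H] is the
    complex Hessian of [S] ([barrier_termE]). The first term is nonpositive at a
    maximum, and the second one by the Cauchy-Schwarz inequality and [S >= 2]. *)

(** * Derivatives along lines *)

Section Lines.
Context {R : realType} {V : normedModType R}.
Implicit Types (f : V -> R) (x v w : V).

Lemma derive_line f x v (s : R) :
  'D_v f (x + s *: v) = 'D_1 (fun h : R => f (x + h *: v)) s.
Proof.
rewrite /derive; set g1 := fun h => h^-1 *: _; set g2 := fun h => h^-1 *: _.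
suff -> : g1 = g2 by [].
rewrite funeqE /g1 /g2 => h /=.
by rewrite [_%:A]mulr1 scalerDl addrCA.
Qed.

Lemma derivable_line f x v (s : R) :
  derivable f (x + s *: v) v <-> derivable (fun h : R => f (x + h *: v)) s 1.
Proof.
rewrite /derivable; set g1 := fun h => h^-1 *: _; set g2 := fun h => h^-1 *: _.
suff -> : g1 = g2 by [].
rewrite funeqE /g1 /g2 => h /=.
by rewrite [_%:A]mulr1 scalerDl addrCA.
Qed.

Lemma is_derive_line f x v (s : R) : derivable f (x + s *: v) v ->
  is_derive s 1 (fun h : R => f (x + h *: v)) ('D_v f (x + s *: v)).
Proof. by move=> df; split; [exact/derivable_line | rewrite derive_line]. Qed.

Lemma is_derive_continuous (p : R -> R) (s l : R) :
  is_derive s 1 p l -> {for s, continuous p}.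
Proof. by move=> [dp _]; apply/differentiable_continuous/derivable1_diffP. Qed.

Lemma mean_value (p dp : R -> R) (h : R) : 0 < h ->
  (forall s, 0 <= s <= h -> is_derive (s : R) (1 : R) p (dp s)) ->
  exists2 c, 0 < c < h & p h - p 0 = dp c * h.
Proof.
move=> h0 dpE.
have [||c] := @MVT R p dp 0 h h0.
- by move=> s; rewrite in_itv /= => /andP[s0 sh]; apply: dpE; rewrite !ltW.
- apply: derivable_within_continuous => s; rewrite in_itv /= => sh.
  by have [] := dpE s sh.
by rewrite in_itv /= subr0 => ch E; exists c.
Qed.

(** Two-parameter families issued from [x] stay in any given neighbourhood;
    this is what makes the finite increments of second order available below. *)
Lemma parallelogram_nbhs x v w (N : set V) : nbhs x N ->
  exists2 d : R, 0 < d &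
    forall a b : R, `|a| <= d -> `|b| <= d -> N (x + a *: v + b *: w).
Proof.
move=> /nbhs_ballP[e /= e0 eN].
have M0 : 0 < `|v| + `|w| + 1.
  by rewrite ltr_wpDl // addr_ge0.
exists (e / (`|v| + `|w| + 1)) => [|a b ad bd]; first by rewrite divr_gt0.
apply: eN; rewrite -ball_normE /= -addrA opprD addrA subrr add0r normrN.
apply: le_lt_trans (ler_normD _ _) _; rewrite !normrZ.
have := ler_wpM2r (normr_ge0 v) ad; have := ler_wpM2r (normr_ge0 w) bd.
set d := e / _; have d0 : 0 < d by rewrite divr_gt0.
have dE : d * (`|v| + `|w| + 1) = e by rewrite divfK // lt0r_neq0.
by rewrite -[in X in _ -> _ -> X]dE !mulrDr; move: d0; clear; lra.
Qed.

End Lines.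

Section ProductSlices.
Context {R : realType} {V : normedModType R}.
Implicit Types (f : R * V -> R) (v z : V) (t : R).

Let space_step v z t (h : R) : h *: ((0, v) : R * V) + (t, z) = (t, h *: v + z).
Proof. by congr pair; rewrite /= ?scaler0 ?add0r. Qed.

Let time_step z t (h : R) : h *: ((1, 0) : R * V) + (t, z) = (h *: 1 + t, z).
Proof. by congr pair; rewrite /= ?scaler0 ?add0r. Qed.

Lemma derive_space_slice f v z t :
  'D_(0, v) f (t, z) = 'D_v (fun w => f (t, w)) z.
Proof.
rewrite /derive; set g1 := fun h => h^-1 *: _; set g2 := fun h => h^-1 *: _.
suff -> : g1 = g2 by [].
by rewrite funeqE /g1 /g2 => h; rewrite [(_ \o _) _]/= space_step.
Qed.

Lemma derive_time_slice f z t : 'D_(1, 0) f (t, z) = 'D_1 (fun s => f (s, z)) t.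
Proof.
rewrite /derive; set g1 := fun h => h^-1 *: _; set g2 := fun h => h^-1 *: _.
suff -> : g1 = g2 by [].
by rewrite funeqE /g1 /g2 => h; rewrite [(_ \o _) _]/= time_step.
Qed.

Lemma is_derive_time_slice f z t (l : R) :
  is_derive (t, z) (1, 0) f l -> is_derive t 1 (fun s => f (s, z)) l.
Proof.
move=> [d1 d2]; split; last by rewrite -d2 derive_time_slice.
move: d1; rewrite /derivable; set g1 := fun h => h^-1 *: _.
set g2 := fun h => h^-1 *: _; suff -> : g1 = g2 by [].
by rewrite funeqE /g1 /g2 => h; rewrite [(_ \o _) _]/= time_step.
Qed.

End ProductSlices.

Section SecondDerivativeTest.
Context {R : realType}.

(** If [dp] had positive slope at [0], where it vanishes, it would be positive
    on some ]0, d], and [p d] would exceed [p 0] by the mean value theorem. *)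
Lemma local_max_deriv2_le0 (p dp : R -> R) (l : R) :
  (\forall s \near (0 : R), is_derive (s : R) (1 : R) p (dp s)) ->
  is_derive (0 : R) (1 : R) dp l ->
  (\forall s \near (0 : R), p s <= p 0) -> dp 0 = 0 /\ l <= 0.
Proof.
move=> /nbhs_ballP[d1 /= d10 D1] D2 /nbhs_ballP[d2 /= d20 M].
have {}D1 (s : R) : `|s| < d1 -> is_derive s 1 p (dp s).
  by move=> sd; apply: D1; rewrite -ball_normE /= sub0r normrN.
have {}M (s : R) : `|s| < d2 -> p s <= p 0.
  by move=> sd; apply: M; rewrite -ball_normE /= sub0r normrN.
have dp0 : dp 0 = 0.
  pose d := Num.min d1 d2; have d0 : 0 < d by rewrite lt_min d10 d20.
  have inI t : t \in `]- d, d[%R -> `|t| < d1 /\ `|t| < d2.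
    rewrite in_itv /= -ltr_norml => td.
    by split; apply: (lt_le_trans td); rewrite ge_min lexx ?orbT.
  have B : is_derive (0 : R) (1 : R) p 0.
    apply: (@derive1_at_max R p (- d) d 0).
    - by rewrite ge0_cp // ltW.
    - by move=> t /inI[/D1[]].
    - by rewrite in_itv /= oppr_lt0 d0.
    - by move=> t /inI[_ /M].
  have [|_ <-] := D1 0; first by rewrite normr0.
  by have [_ ->] := B.
split => //; rewrite leNgt; apply/negP => l0.
have /cvgr_gt/(_ _ l0) : h^-1 *: ((dp \o shift 0) (h *: 1) - dp 0) @[h --> 0^'] --> l.
  by case: D2 => /[swap] <-.
move=> /nbhs_ballP[d3 /= d30 D3].
pose d := Num.min d1 (Num.min d2 d3) / 2.
have m0 : 0 < Num.min d1 (Num.min d2 d3) by rewrite !lt_min d10 d20 d30.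
have d0 : 0 < d by rewrite divr_gt0.
have dm : d < Num.min d1 (Num.min d2 d3) by move: m0; rewrite /d; lra.
move: dm; rewrite !lt_min => /and3P[dd1 dd2 dd3].
have [s /andP[s0 sd]|c /andP[c0 cd] E] := @mean_value R p dp d d0.
  by apply: D1; rewrite ger0_norm // (le_lt_trans sd).
have := D3 c; rewrite -ball_normE /= sub0r normrN gtr0_norm // (lt_trans cd) //.
move=> /(_ isT (lt0r_neq0 c0)); rewrite /= addr0 [_%:A]mulr1 dp0 subr0.
rewrite pmulr_rgt0 ?invr_gt0 // => dpc.
have := M d; rewrite gtr0_norm // => /(_ dd2).
by rewrite -subr_le0 E leNgt mulr_gt0.
Qed.

End SecondDerivativeTest.

(** * Smooth functions on an open set *)

Section SmoothCalculus.
Context {R : realType} {V : normedModType R}.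
Variable U : set V.
Hypothesis oU : open U.
Implicit Types (f g : V -> R) (v w x : V).

Definition C0_derivable f : Prop :=
  forall x, U x -> {for x, continuous f} /\ forall v, derivable f x v.

(** Smoothness is a statement about all words of directions, which does not
    combine well with the Leibniz rule; this stratification by order turns the
    closure properties into inductions on the order. *)
Fixpoint Ck (m : nat) f : Prop :=
  C0_derivable f /\ (if m is m'.+1 then forall v, Ck m' ('D_v f) else True).

Lemma smooth_Ck f : smooth_open U f <-> forall m, Ck m f.
Proof.
split.
  move=> sf m; elim: m f sf => [|m IH] f sf.
    by split; [exact: (sf [::]) | exact: I].
  split; first exact: (sf [::]).
  by move=> v; apply: IH => vs x; exact: (sf (v :: vs) x).
move=> h vs; elim: vs f h => [|v vs IH] f h.
  by have [h0 _] := h 0%N; exact: h0.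
by apply: (IH ('D_v f)) => m; have [_] := h m.+1; apply.
Qed.

Lemma near_eq_of_open f g x : {in U, f =1 g} -> U x -> \near x, f x = g x.
Proof.
move=> fg Ux; have := open_nbhs_nbhs (conj oU Ux).
by apply: filterS => y Uy; apply: fg; rewrite inE.
Qed.

Lemma derive_eq_on f g v : {in U, f =1 g} -> {in U, 'D_v f =1 'D_v g}.
Proof.
by move=> fg x; rewrite inE => Ux; apply/near_eq_derive/near_eq_of_open.
Qed.

Lemma C0_derivable_eq_on f g : {in U, f =1 g} -> C0_derivable f -> C0_derivable g.
Proof.
move=> fg hf x Ux; have [cf df] := hf x Ux; have nfg := near_eq_of_open fg Ux.
split; last by move=> v; apply: near_eq_derivable (df v).
move: cf; rewrite /prop_for /continuous_at (nbhs_singleton nfg).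
by move=> /(cvg_trans _); apply; apply/near_eq_cvg; apply: filterS nfg => y ->.
Qed.

Lemma Ck_eq_on m f g : {in U, f =1 g} -> Ck m f -> Ck m g.
Proof.
elim: m f g => [|m IH] f g fg [h1 h2]; (split; first exact: C0_derivable_eq_on h1).
  exact: I.
by move=> v; apply: IH (h2 v); apply: derive_eq_on.
Qed.

Lemma smooth_eq_on f g : {in U, f =1 g} -> smooth_open U f -> smooth_open U g.
Proof.
by move=> fg /smooth_Ck sf; apply/smooth_Ck => m; apply: Ck_eq_on (sf m).
Qed.

Lemma smooth_continuous f x : smooth_open U f -> U x -> {for x, continuous f}.
Proof. by move=> sf Ux; have [] := sf [::] x Ux. Qed.

Lemma smooth_derivable f x v : smooth_open U f -> U x -> derivable f x v.
Proof. by move=> sf Ux; have [_] := sf [::] x Ux; apply. Qed.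

Lemma smooth_derive f v : smooth_open U f -> smooth_open U ('D_v f).
Proof. by move=> sf vs x Ux; exact: (sf (v :: vs) x Ux). Qed.

Lemma CkW m f : Ck m.+1 f -> Ck m f.
Proof.
elim: m f => [|m IH] f [h1 h2]; first by split; [exact: h1 | exact: I].
by split; [exact: h1 | move=> v; apply: IH; exact: h2].
Qed.

Lemma Ck_C0 m f : Ck m f -> C0_derivable f.
Proof. by case: m => [|m] []. Qed.

Lemma C0_derivableD f g : C0_derivable f -> C0_derivable g ->
  C0_derivable (fun x => f x + g x).
Proof.
move=> hf hg x Ux; have [cf df] := hf x Ux; have [cg dg] := hg x Ux.
by split=> [|v]; [exact: (cvgD cf cg) | exact: (derivableD (df v) (dg v))].
Qed.

Lemma C0_derivableM f g : C0_derivable f -> C0_derivable g ->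
  C0_derivable (fun x => f x * g x).
Proof.
move=> hf hg x Ux; have [cf df] := hf x Ux; have [cg dg] := hg x Ux.
by split=> [|v]; [exact: (cvgM cf cg) | exact: (derivableM (df v) (dg v))].
Qed.

Lemma CkD m f g : Ck m f -> Ck m g -> Ck m (fun x => f x + g x).
Proof.
elim: m f g => [|m IH] f g hf hg;
  (split; first exact: C0_derivableD (Ck_C0 hf) (Ck_C0 hg)); first exact: I.
move=> v; case: hf => hf1 hf2; case: hg => hg1 hg2.
apply: Ck_eq_on (IH _ _ (hf2 v) (hg2 v)) => x; rewrite inE => Ux.
have [_ df] := hf1 x Ux; have [_ dg] := hg1 x Ux.
by rewrite -(deriveD (df v) (dg v)).
Qed.

Lemma CkM m f g : Ck m f -> Ck m g -> Ck m (fun x => f x * g x).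
Proof.
elim: m f g => [|m IH] f g hf hg;
  (split; first exact: C0_derivableM (Ck_C0 hf) (Ck_C0 hg)); first exact: I.
move=> v; have hf' := CkW hf; have hg' := CkW hg.
case: hf => hf1 hf2; case: hg => hg1 hg2.
apply: Ck_eq_on (CkD (IH _ _ hf' (hg2 v)) (IH _ _ hg' (hf2 v))) => x.
rewrite inE => Ux; have [_ df] := hf1 x Ux; have [_ dg] := hg1 x Ux.
by rewrite (deriveM (df v) (dg v)).
Qed.

Lemma Ck_cst m (c : R) : Ck m (fun=> c).
Proof.
have C0 a : C0_derivable (fun=> a).
  by move=> x Ux; split => [|v]; [exact: cvg_cst | exact: derivable_cst].
elim: m c => [|m IH] c; (split; first exact: C0); first exact: I.
by move=> v; apply: Ck_eq_on (IH 0) => x _; rewrite derive_cst.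
Qed.

Lemma CkV m f : (forall x, U x -> f x != 0) -> Ck m f -> Ck m (fun x => (f x)^-1).
Proof.
move=> f0.
have C0 : C0_derivable f -> C0_derivable (fun x => (f x)^-1).
  move=> hf x Ux; have [cf df] := hf x Ux; have fx0 := f0 x Ux.
  by split=> [|v]; [exact: (cvgV fx0 cf) | exact: (derivableV fx0 (df v))].
elim: m => [|m IH] hf; (split; first exact: C0 (Ck_C0 hf)); first exact: I.
move=> v; have hf' := CkW hf; case: hf => hf1 hf2.
apply: (@Ck_eq_on _ (fun x => -1 * ('D_v f x * ((f x)^-1 * (f x)^-1)))).
  move=> x; rewrite inE => Ux; have [_ df] := hf1 x Ux.
  by rewrite (deriveV (f0 x Ux) (df v)) -invfM -expr2 mulN1r scaleNr mulrC.
exact: (CkM (Ck_cst m (-1)) (CkM (hf2 v) (CkM (IH hf') (IH hf')))).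
Qed.

Lemma is_derive_ln_comp f x v : 0 < f x -> derivable f x v ->
  is_derive x v (fun y => ln (f y)) ('D_v f x / f x).
Proof.
move=> f0 df; pose p (h : R) := f (x + h *: v).
have x0 : x + 0 *: v = x by rewrite scale0r addr0.
have p0 : 0 < p 0 by rewrite /p x0.
have D1 : is_derive (0 : R) (1 : R) p ('D_v f x).
  by have := @is_derive_line R V f x v 0; rewrite x0; exact.
have [d2 e2] := is_derive1_comp (is_derive1_ln p0) D1.
have L := derivable_line (fun y => ln (f y)) x v 0.
have E := derive_line (fun y => ln (f y)) x v 0.
rewrite x0 in L E; split; first by apply/L; exact: d2.
by rewrite E; apply: (etrans e2); rewrite /p x0 mulrC.
Qed.

Lemma Ck_ln m f : (forall x, U x -> 0 < f x) -> Ck m f -> Ck m (fun x => ln (f x)).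
Proof.
move=> f0.
have C0 : C0_derivable f -> C0_derivable (fun x => ln (f x)).
  move=> hf x Ux; have [cf df] := hf x Ux; split=> [|v].
    exact: (continuous_comp cf (continuous_ln (f0 x Ux))).
  by have [] := is_derive_ln_comp (f0 x Ux) (df v).
case: m => [|m] hf; (split; first exact: C0 (Ck_C0 hf)); first exact: I.
move=> v; have hf' := CkW hf; case: hf => hf1 hf2.
apply: (@Ck_eq_on _ (fun x => 'D_v f x * (f x)^-1)).
  move=> x; rewrite inE => Ux; have [_ df] := hf1 x Ux.
  by have [_ ->] := is_derive_ln_comp (f0 x Ux) (df v).
by apply: (CkM (hf2 v)); apply: CkV hf' => x /f0 /lt0r_neq0.
Qed.

Lemma smooth_cst (c : R) : smooth_open U (fun=> c).
Proof. by apply/smooth_Ck => m; exact: Ck_cst. Qed.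

Lemma smoothD f g : smooth_open U f -> smooth_open U g ->
  smooth_open U (fun x => f x + g x).
Proof.
by move=> /smooth_Ck sf /smooth_Ck sg; apply/smooth_Ck => m; exact: CkD.
Qed.

Lemma smoothM f g : smooth_open U f -> smooth_open U g ->
  smooth_open U (fun x => f x * g x).
Proof.
by move=> /smooth_Ck sf /smooth_Ck sg; apply/smooth_Ck => m; exact: CkM.
Qed.

Lemma smoothN f : smooth_open U f -> smooth_open U (fun x => - f x).
Proof.
move=> sf; apply: (smooth_eq_on _ (smoothM (smooth_cst (-1)) sf)) => x _.
by rewrite mulN1r.
Qed.

Lemma smoothB f g : smooth_open U f -> smooth_open U g ->
  smooth_open U (fun x => f x - g x).
Proof. by move=> sf sg; exact: (smoothD sf (smoothN sg)). Qed.

Lemma smoothV f : (forall x, U x -> f x != 0) -> smooth_open U f ->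
  smooth_open U (fun x => (f x)^-1).
Proof. by move=> f0 /smooth_Ck sf; apply/smooth_Ck => m; exact: CkV. Qed.

Lemma smooth_ln f : (forall x, U x -> 0 < f x) -> smooth_open U f ->
  smooth_open U (fun x => ln (f x)).
Proof. by move=> f0 /smooth_Ck sf; apply/smooth_Ck => m; exact: Ck_ln. Qed.

End SmoothCalculus.

Lemma double_difference_swap {R : realType} (p q r t : R) :
  p - q - (r - t) = p - r - (q - t).
Proof. by ring. Qed.

Lemma two_close {R : realType} (p q m e : R) :
  `|p - m| < e / 2 -> `|q - m| < e / 2 -> `|q - p| <= e.
Proof.
rewrite !ltr_norml ler_norml => /andP[? ?] /andP[? ?].
by apply/andP; split; lra.
Qed.

Lemma two_close_sum {R : realType} (p q p' q' l e : R) :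
  `|l - (p' + q')| < e / 3 -> `|p - p'| < e / 3 -> `|q - q'| < e / 3 ->
  `|l - (p + q)| <= e.
Proof.
rewrite !ltr_norml ler_norml => /andP[? ?] /andP[? ?] /andP[? ?].
by apply/andP; split; lra.
Qed.

Section SecondOrder.
Context {R : realType} {V : normedModType R}.
Variable U : set V.
Hypothesis oU : open U.
Implicit Types (f : V -> R) (x v w : V).

Let pt (x v w : V) (a b : R) := x + a *: v + b *: w.

(** Additivity in the direction comes from continuity of the partial
    derivatives: the increment along [v + w] splits into one along [v] and one
    along [w], and each is evaluated by the mean value theorem. *)
Lemma smooth_deriveDv f x v w : smooth_open U f -> U x ->
  'D_(v + w) f x = 'D_v f x + 'D_w f x.
Proof.
move=> sf Ux; apply/eqP; rewrite -subr_eq0; apply/eqP.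
set m := 'D_v f x + 'D_w f x; set l := 'D_(v + w) f x.
apply/eqP; rewrite -normr_eq0 eq_le normr_ge0 andbT; apply/ler_addgt0Pr => e e0.
rewrite add0r.
have e30 : 0 < e / 3 by rewrite divr_gt0.
have c1 := smooth_continuous (smooth_derive v sf) Ux.
have c2 := smooth_continuous (smooth_derive w sf) Ux.
have N1 : \forall y \near x, [/\ U y, `|'D_v f x - 'D_v f y| < e / 3 &
    `|'D_w f x - 'D_w f y| < e / 3].
  move/cvgr_dist_lt: c1 => /(_ _ e30) A1; move/cvgr_dist_lt: c2 => /(_ _ e30) A2.
  apply: filterS3 (open_nbhs_nbhs (conj oU Ux)) A1 A2 => y h1 h2 h3.
  exact: And3 h1 h2 h3.
have [d d0 D] := parallelogram_nbhs v w N1.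
have /cvgr_dist_lt/(_ _ e30) :
    h^-1 *: ((f \o shift x) (h *: (v + w)) - f x) @[h --> 0^'] --> l.
  exact: (smooth_derivable sf Ux).
move=> /nbhs_ballP[d3 /= d30 D3].
pose h := Num.min d d3 / 2.
have m0 : 0 < Num.min d d3 by rewrite lt_min d0 d30.
have h0 : 0 < h by rewrite divr_gt0.
have hm : h < Num.min d d3 by move: m0; rewrite /h; lra.
move: hm; rewrite lt_min => /andP[hd hd3].
have := D3 h; rewrite -ball_normE /= sub0r normrN gtr0_norm // hd3.
move=> /(_ isT (lt0r_neq0 h0)).
have D' a b : 0 <= a <= h -> 0 <= b <= h -> [/\ U (pt x v w a b),
    `|'D_v f x - 'D_v f (pt x v w a b)| < e / 3 &
    `|'D_w f x - 'D_w f (pt x v w a b)| < e / 3].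
  move=> /andP[a0 ah] /andP[b0 bh]; apply: D; rewrite ger0_norm //.
    by apply: (le_trans ah); apply: ltW.
  by apply: (le_trans bh); apply: ltW.
have hh : 0 <= h <= h by rewrite lexx ltW.
have zh : 0 <= (0 : R) <= h by rewrite lexx ltW.
have [s sh|c1' /andP[c10 c1h] E1] := @mean_value R (fun s => f (x + s *: v))
    (fun s => 'D_v f (x + s *: v)) h h0.
  apply: is_derive_line; apply: smooth_derivable sf _.
  by have [] := D' s 0 sh zh; rewrite /pt scale0r addr0.
have [s sh|c2' /andP[c20 c2h] E2] := @mean_value R
    (fun s => f (x + h *: v + s *: w)) (fun s => 'D_w f (x + h *: v + s *: w)) h h0.
  apply: is_derive_line; apply: smooth_derivable sf _.
  by have [] := D' h s hh sh.
rewrite scale0r addr0 in E1; rewrite scale0r addr0 in E2.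
have -> : f (h *: (v + w) + x) - f x = ('D_v f (x + c1' *: v) +
    'D_w f (x + h *: v + c2' *: w)) * h.
  rewrite mulrDl -E1 -E2 scalerDr.
  have -> : h *: v + h *: w + x = x + h *: v + h *: w by rewrite addrC addrA.
  by ring.
rewrite [_ *: (_ * h)]mulrC mulfK ?lt0r_neq0 // => B.
have [|_ B1 _] := D' c1' 0 _ zh; first by rewrite !ltW.
have [|_ _ B2] := D' h c2' hh; first by rewrite !ltW.
by rewrite /pt scale0r addr0 in B1; exact: two_close_sum B B1 B2.
Qed.

Lemma smooth_deriveZv f x v (c : R) : smooth_open U f -> U x ->
  'D_(c *: v) f x = c * 'D_v f x.
Proof.
move=> sf Ux.
have -> : 'D_(c *: v) f x = 'D_1 (fun h : R => f (x + (c * h) *: v)) 0.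
  have := derive_line f x (c *: v) 0; rewrite scale0r addr0 => ->.
  suff -> : (fun h : R => f (x + h *: (c *: v))) =
            (fun h : R => f (x + (c * h) *: v)) by [].
  by apply/funext => h; rewrite scalerA mulrC.
pose p := fun h : R => f (x + h *: v).
have D1 : is_derive (c * 0 : R) (1 : R) p ('D_v f x).
  have := @is_derive_line R V f x v (c * 0); rewrite mulr0 scale0r addr0; apply.
  exact: (smooth_derivable sf Ux).
have D2 : is_derive (0 : R) (1 : R) ( *%R c) (c * 1).
  have := @is_deriveZ _ _ _ (@id R) c (0 : R) 1 1 (is_derive_id _ _).
  by [].
have := @is_derive1_comp R p ( *%R c) 0 _ _ D1 D2.
by move=> [_]; rewrite mulr1 mulrC.
Qed.

(** Two applications of the mean value theorem to the second difference over a
    parallelogram. *)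
Lemma mixed_difference f x v w (h : R) : smooth_open U f -> 0 < h ->
  (forall a b : R, 0 <= a <= h -> 0 <= b <= h -> U (pt x v w a b)) ->
  exists a b, [/\ 0 <= a <= h, 0 <= b <= h &
    f (pt x v w h h) - f (pt x v w h 0) - (f (pt x v w 0 h) - f (pt x v w 0 0)) =
    'D_w ('D_v f) (pt x v w a b) * h * h].
Proof.
move=> sf h0 hU.
have hh : 0 <= h <= h by rewrite lexx ltW.
have zh : 0 <= (0 : R) <= h by rewrite lexx ltW.
have ptC a b : pt x v w a b = x + b *: w + a *: v by rewrite /pt addrAC.
have [s sh|a /andP[a0 ah] E1] := @mean_value R
    (fun s => f (pt x v w s h) - f (pt x v w s 0))
    (fun s => 'D_v f (pt x v w s h) - 'D_v f (pt x v w s 0)) h h0.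
  have H b : 0 <= b <= h -> is_derive s 1 (fun s => f (pt x v w s b))
      ('D_v f (pt x v w s b)).
    move=> bh; have -> : (fun s => f (pt x v w s b)) = (fun s => f (x + b *: w + s *: v)).
      by apply/funext => r; rewrite ptC.
    rewrite ptC; apply: is_derive_line; rewrite -ptC; apply: smooth_derivable sf _.
    exact: hU.
  by apply: is_deriveB; exact: H.
have ah' : 0 <= a <= h by rewrite !ltW.
have [s sh|b /andP[b0 bh] E2] := @mean_value R
    (fun s => 'D_v f (pt x v w a s)) (fun s => 'D_w ('D_v f) (pt x v w a s)) h h0.
  apply: is_derive_line; apply: smooth_derivable (smooth_derive v sf) _.
  exact: hU.
by exists a, b; split; rewrite ?ah' //= ?(ltW b0) ?(ltW bh) // E1 E2.
Qed.

(** Schwarz's theorem: the second difference over a small parallelogram is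
    symmetric in [v] and [w], and equals [h^2] times either mixed derivative
    at a nearby point. *)
Lemma smooth_deriveC f x v w : smooth_open U f -> U x ->
  'D_v ('D_w f) x = 'D_w ('D_v f) x.
Proof.
move=> sf Ux; apply/eqP; rewrite -subr_eq0 -normr_eq0 eq_le normr_ge0 andbT.
apply/ler_addgt0Pr => e e0; rewrite add0r.
have e20 : 0 < e / 2 by rewrite divr_gt0.
have c1 := smooth_continuous (smooth_derive w (smooth_derive v sf)) Ux.
have c2 := smooth_continuous (smooth_derive v (smooth_derive w sf)) Ux.
have N1 : \forall y \near x, [/\ U y,
    `|'D_w ('D_v f) x - 'D_w ('D_v f) y| < e / 2 &
    `|'D_v ('D_w f) x - 'D_v ('D_w f) y| < e / 2].
  move/cvgr_dist_lt: c1 => /(_ _ e20) A1; move/cvgr_dist_lt: c2 => /(_ _ e20) A2.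
  apply: filterS3 (open_nbhs_nbhs (conj oU Ux)) A1 A2 => y h1 h2 h3.
  exact: And3 h1 h2 h3.
have [h h0 D] := parallelogram_nbhs v w N1.
have D' a b : 0 <= a <= h -> 0 <= b <= h -> [/\ U (pt x v w a b),
    `|'D_w ('D_v f) x - 'D_w ('D_v f) (pt x v w a b)| < e / 2 &
    `|'D_v ('D_w f) x - 'D_v ('D_w f) (pt x v w a b)| < e / 2].
  by move=> /andP[a0 ah] /andP[b0 bh]; apply: D; rewrite ger0_norm.
have [a b ah bh|a [b [ah bh E1]]] := @mixed_difference f x v w h sf h0.
  by case: (D' a b ah bh).
have ptC a' b' : pt x w v a' b' = pt x v w b' a' by rewrite /pt addrAC.
have [a' b' ah' bh'|b' [a' [bh' ah' E2]]] := @mixed_difference f x w v h sf h0.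
  by rewrite ptC; case: (D' b' a' bh' ah').
rewrite !ptC in E2.
have E : 'D_w ('D_v f) (pt x v w a b) = 'D_v ('D_w f) (pt x v w a' b').
  apply: (mulIf (lt0r_neq0 h0)); apply: (mulIf (lt0r_neq0 h0)).
  exact: (etrans (esym E1) (etrans (double_difference_swap _ _ _ _) E2)).
have [_ B1 _] := D' a b ah bh; have [_ _ B2] := D' a' b' ah' bh'.
by rewrite E in B1; exact: two_close B1 B2.
Qed.

End SecondOrder.

Section SmoothRules.
Context {R : realType} {V : normedModType R}.
Variable U : set V.
Hypothesis oU : open U.
Implicit Types (f g : V -> R) (v x : V).

Lemma smooth_deriveD f g v x : smooth_open U f -> smooth_open U g -> U x ->
  'D_v (fun y => f y + g y) x = 'D_v f x + 'D_v g x.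
Proof.
move=> sf sg Ux.
exact: (deriveD (smooth_derivable sf Ux) (smooth_derivable sg Ux)).
Qed.

Lemma smooth_deriveB f g v x : smooth_open U f -> smooth_open U g -> U x ->
  'D_v (fun y => f y - g y) x = 'D_v f x - 'D_v g x.
Proof.
move=> sf sg Ux.
exact: (deriveB (smooth_derivable sf Ux) (smooth_derivable sg Ux)).
Qed.

Lemma smooth_deriveN f v x : smooth_open U f -> U x ->
  'D_v (fun y => - f y) x = - 'D_v f x.
Proof. by move=> sf Ux; exact: (deriveN (smooth_derivable sf Ux)). Qed.

Lemma smooth_deriveM f g v x : smooth_open U f -> smooth_open U g -> U x ->
  'D_v (fun y => f y * g y) x = 'D_v f x * g x + f x * 'D_v g x.
Proof.
move=> sf sg Ux.
rewrite (deriveM (smooth_derivable sf Ux) (smooth_derivable sg Ux)).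
by rewrite addrC; congr (_ + _); exact: mulrC.
Qed.

End SmoothRules.

Section LineMaximum.
Context {R : realType} {V : normedModType R}.
Variable U : set V.
Hypothesis oU : open U.

Lemma near_line (x v : V) : U x -> \forall s \near (0 : R), U (x + s *: v).
Proof.
move=> Ux; have [d d0 D] := parallelogram_nbhs v 0 (open_nbhs_nbhs (conj oU Ux)).
apply/nbhs_ballP; exists d => //= s; rewrite -ball_normE /= sub0r normrN => sd.
by have := D s 0; rewrite scale0r addr0; apply; rewrite ?normr0 ltW.
Qed.

(** First and second order conditions at a maximum, along a line, of a
    function perturbed by the logarithm of a quadratic polynomial. The
    perturbation accounts for the factor [|1 + zeta x_k|^2] of the barrier;
    with [b = c = 0] this is the plain second derivative test. *)
Lemma line_max (u : V -> R) (x v : V) (b c : R) : smooth_open U u -> U x ->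
  (\forall s \near (0 : R), 0 < 1 + b * s + c * s ^+ 2 ->
     u (x + s *: v) + ln (1 + b * s + c * s ^+ 2) <= u x) ->
  'D_v u x + b = 0 /\ 'D_v ('D_v u) x + 2 * c - b ^+ 2 <= 0.
Proof.
move=> su Ux M.
pose N (s : R) := 1 + b * s + c * s ^+ 2.
pose dN (s : R) := b + 2 * c * s.
have N1 : N 0 = 1 by rewrite /N expr2 !mulr0 !addr0.
have dNE s : is_derive (s : R) (1 : R) N (dN s).
  have P : is_derive (s : R) (1 : R)
      (fun s : R => 1 + b * s + c * (s * s)) (0 + b *: 1 + c *: (s *: 1 + s *: 1)).
    have I1 := is_derive_id s (1 : R).
    exact: (is_deriveD (is_deriveD (is_derive_cst (1 : R) s 1) (is_deriveZ b I1))
      (is_deriveZ c (is_deriveM I1 I1))).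
  have <- : 0 + b *: 1 + c *: (s *: 1 + s *: 1) = dN s.
    by rewrite /dN /GRing.scale /=; ring.
  suff -> : N = fun s : R => 1 + b * s + c * (s * s) by exact: P.
  by apply/funext => r; rewrite /N expr2.
have Npos : \forall s \near (0 : R), 0 < N s.
  have cN : {for 0, continuous N} by exact: is_derive_continuous (dNE 0).
  move/cvgr_gt: cN => /(_ 0); rewrite N1 => /(_ ltr01); exact.
pose p (s : R) := u (x + s *: v) + ln (N s).
pose dp (s : R) := 'D_v u (x + s *: v) + dN s * (N s)^-1.
have x0 : x + 0 *: v = x by rewrite scale0r addr0.
have [|||d0 d2] := @local_max_deriv2_le0 R p dp
    ('D_v ('D_v u) x + (2 * c - b ^+ 2)).
- apply: filterS2 (near_line v Ux) Npos => s Us Ns.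
  have D1 := is_derive_line (smooth_derivable (v := v) su Us).
  have D2 := is_derive1_comp (is_derive1_ln Ns) (dNE s).
  by have := is_deriveD D1 D2; rewrite mulrC.
- have sd := smooth_derive v su.
  have Ux0 : U (x + 0 *: v) by rewrite x0.
  have D1 := is_derive_line (smooth_derivable (v := v) sd Ux0).
  rewrite x0 in D1.
  have N0 : N 0 != 0 by rewrite N1 oner_neq0.
  have DdN : is_derive (0 : R) (1 : R) dN (2 * c).
    have := is_deriveD (is_derive_cst b (0 : R) (1 : R))
      (is_deriveZ (2 * c) (is_derive_id (0 : R) (1 : R))).
    by rewrite add0r /GRing.scale /= mulr1.
  have DV : is_derive (0 : R) (1 : R) (fun s => (N s)^-1) (- b).
    have [dN0 dN0E] := dNE 0; split; first exact: derivableV.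
    by rewrite deriveV // dN0E N1 /dN mulr0 addr0 expr1n invr1 /GRing.scale /= mulN1r.
  have := is_deriveD D1 (is_deriveM DdN DV).
  suff -> : dN 0 *: - b + (N 0)^-1 *: (2 * c) = 2 * c - b ^+ 2 by [].
  by rewrite N1 /dN /GRing.scale /= invr1; ring.
- by apply: filterS2 M Npos => s Ms /Ms; rewrite /p x0 N1 ln1 addr0.
split; last by rewrite -addrA; exact: d2.
by move: d0; rewrite /dp x0 N1 invr1 mulr1 /dN mulr0 addr0.
Qed.

(** Only the linearity of the increment matters, which makes the difference
    quotient constant. *)
Lemma is_derive_linear (l : V -> R) :
  (forall (h : R) (v x : V), l (h *: v + x) = h * l v + l x) ->
  forall v x : V, is_derive x v l (l v).
Proof.
move=> lE v x.
have Q : (fun h => h^-1 *: ((l \o shift x) (h *: v) - l x)) @ 0^' --> l v.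
  apply/cvgrPdist_lt => e e0; apply/nbhs_ballP; exists 1 => //= h _ h0.
  by rewrite lE addrK /GRing.scale /= mulKf // subrr normr0.
by split; [apply/cvg_ex; exists (l v) | exact: cvg_lim].
Qed.

Lemma smooth_linear (l : V -> R) :
  (forall (h : R) (v x : V), l (h *: v + x) = h * l v + l x) -> continuous l ->
  smooth_open U l.
Proof.
move=> lE cl; have dl := is_derive_linear lE.
have C0 x : U x -> {for x, continuous l} /\ forall v, derivable l x v.
  by move=> _; split => [|v]; [exact: cl | have [] := dl v x].
apply/(smooth_Ck U) => -[|m]; first by split => // x Ux; exact: C0.
split => [x Ux|v]; first exact: C0.
apply: (Ck_eq_on oU _ (Ck_cst oU m (l v))) => x _.
by have [_ ->] := dl v x.
Qed.

End LineMaximum.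

(** * Wirtinger calculus *)

Section ComplexSmooth.
Context {R : realType} {n : nat}.
Variable U : set (Cn R n).
Hypothesis oU : open U.
Implicit Types (f g : Cn R n -> R[i]) (v w z : Cn R n) (c : R[i]).

Lemma ReD (x y : R[i]) : complex.Re (x + y) = complex.Re x + complex.Re y.
Proof. by case: x; case: y. Qed.
Lemma ImD (x y : R[i]) : complex.Im (x + y) = complex.Im x + complex.Im y.
Proof. by case: x; case: y. Qed.
Lemma ReM (x y : R[i]) : complex.Re (x * y) =
  complex.Re x * complex.Re y - complex.Im x * complex.Im y.
Proof. by case: x; case: y. Qed.
Lemma ImM (x y : R[i]) : complex.Im (x * y) =
  complex.Re x * complex.Im y + complex.Im x * complex.Re y.
Proof. by case: x; case: y. Qed.
Lemma ReJ (x : R[i]) : complex.Re (x^*%R) = complex.Re x.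
Proof. by case: x. Qed.
Lemma ImJ (x : R[i]) : complex.Im (x^*%R) = - complex.Im x.
Proof. by case: x. Qed.
Lemma Re_sum (I : Type) (r : seq I) (P : pred I) (F : I -> R[i]) :
  complex.Re (\sum_(i <- r | P i) F i) = \sum_(i <- r | P i) complex.Re (F i).
Proof. by elim/big_rec2: _ => // i x y _ <-; rewrite ReD. Qed.

Lemma complex_ext (x y : R[i]) :
  complex.Re x = complex.Re y -> complex.Im x = complex.Im y -> x = y.
Proof. by case: x => a b; case: y => a' b' /= -> ->. Qed.

(** Smoothness of a complex-valued function is carried by its two real
    components, since the directional derivatives are defined componentwise. *)
Definition csmooth f : Prop :=
  smooth_open U (fun z => complex.Re (f z)) /\
  smooth_open U (fun z => complex.Im (f z)).

Lemma csmooth_eq_on f g : {in U, f =1 g} -> csmooth f -> csmooth g.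
Proof.
move=> fg [s1 s2]; split.
  by apply: (smooth_eq_on oU _ s1) => z /fg ->.
by apply: (smooth_eq_on oU _ s2) => z /fg ->.
Qed.

Lemma csmooth_cst c : csmooth (fun=> c).
Proof.
by split; [exact: (smooth_cst oU (complex.Re c))
         | exact: (smooth_cst oU (complex.Im c))].
Qed.

Lemma csmooth_real (u : Cn R n -> R) : smooth_open U u ->
  csmooth (fun z => (u z)%:C).
Proof. by move=> su; split; [exact: su | exact: (smooth_cst oU 0)]. Qed.

Lemma csmoothD f g : csmooth f -> csmooth g -> csmooth (fun z => f z + g z).
Proof.
move=> [f1 f2] [g1 g2]; split.
  by apply: (smooth_eq_on oU _ (smoothD oU f1 g1)) => z _; rewrite ReD.
by apply: (smooth_eq_on oU _ (smoothD oU f2 g2)) => z _; rewrite ImD.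
Qed.

Lemma csmoothM f g : csmooth f -> csmooth g -> csmooth (fun z => f z * g z).
Proof.
move=> [f1 f2] [g1 g2]; split.
  apply: (smooth_eq_on oU _ (smoothB oU (smoothM oU f1 g1) (smoothM oU f2 g2))).
  by move=> z _; rewrite ReM.
apply: (smooth_eq_on oU _ (smoothD oU (smoothM oU f1 g2) (smoothM oU f2 g1))).
by move=> z _; rewrite ImM.
Qed.

Lemma csmoothJ f : csmooth f -> csmooth (fun z => (f z)^*%R).
Proof.
move=> [f1 f2]; split.
  by apply: (smooth_eq_on oU _ f1) => z _; rewrite ReJ.
by apply: (smooth_eq_on oU _ (smoothN oU f2)) => z _; rewrite ImJ.
Qed.

Lemma csmoothN f : csmooth f -> csmooth (fun z => - f z).
Proof.
move=> sf; apply: (csmooth_eq_on _ (csmoothM (csmooth_cst (-1)) sf)).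
by move=> z _; rewrite mulN1r.
Qed.

Lemma csmoothB f g : csmooth f -> csmooth g -> csmooth (fun z => f z - g z).
Proof. by move=> sf sg; exact: (csmoothD sf (csmoothN sg)). Qed.

Lemma csmoothZ c f : csmooth f -> csmooth (fun z => c * f z).
Proof. by move=> sf; exact: (csmoothM (csmooth_cst c) sf). Qed.

Lemma csmooth_sum (I : Type) (r : seq I) (F : I -> Cn R n -> R[i]) :
  (forall i, csmooth (F i)) -> csmooth (fun z => \sum_(i <- r) F i z).
Proof.
move=> sF; elim: r => [|i r IH].
  by apply: (csmooth_eq_on _ (csmooth_cst 0)) => z _; rewrite big_nil.
by apply: (csmooth_eq_on _ (csmoothD (sF i) IH)) => z _; rewrite big_cons.
Qed.

Lemma csmooth_prod (I : Type) (r : seq I) (F : I -> Cn R n -> R[i]) :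
  (forall i, csmooth (F i)) -> csmooth (fun z => \prod_(i <- r) F i z).
Proof.
move=> sF; elim: r => [|i r IH].
  by apply: (csmooth_eq_on _ (csmooth_cst 1)) => z _; rewrite big_nil.
by apply: (csmooth_eq_on _ (csmoothM (sF i) IH)) => z _; rewrite big_cons.
Qed.

Lemma csmooth_det m (g : Cn R n -> 'M[R[i]]_m) :
  (forall i j, csmooth (fun z => g z i j)) -> csmooth (fun z => \det (g z)).
Proof.
move=> sg.
have sp (s : {perm 'I_m}) :
    csmooth (fun z => (-1) ^+ s * \prod_i g z i (s i)).
  exact: (csmoothZ _ (csmooth_prod _ (fun i => sg i (s i)))).
exact: (csmooth_sum _ sp).
Qed.

Lemma csmooth_derive_C v f : csmooth f -> csmooth (derive_C v f).
Proof.
by move=> [f1 f2]; split; [exact: (smooth_derive v f1)|exact: (smooth_derive v f2)].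
Qed.

Lemma derive_C_eq_on v f g : {in U, f =1 g} -> {in U, derive_C v f =1 derive_C v g}.
Proof.
move=> fg z Uz.
have E1 : {in U, (fun y => complex.Re (f y)) =1 (fun y => complex.Re (g y))}.
  by move=> y /fg ->.
have E2 : {in U, (fun y => complex.Im (f y)) =1 (fun y => complex.Im (g y))}.
  by move=> y /fg ->.
by rewrite /derive_C (derive_eq_on oU v E1 Uz) (derive_eq_on oU v E2 Uz).
Qed.

Lemma derive_C_cst v c z : derive_C v (fun=> c) z = 0.
Proof. by rewrite /derive_C !derive_cst. Qed.

Lemma derive_CD v f g z : csmooth f -> csmooth g -> U z ->
  derive_C v (fun w => f w + g w) z = derive_C v f z + derive_C v g z.
Proof.
move=> [f1 f2] [g1 g2] Uz; rewrite /derive_C; under eq_fun do rewrite ReD.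
under [in X in _ +i* X]eq_fun do rewrite ImD.
by rewrite (smooth_deriveD v f1 g1 Uz) (smooth_deriveD v f2 g2 Uz).
Qed.

Lemma derive_CM v f g z : csmooth f -> csmooth g -> U z ->
  derive_C v (fun w => f w * g w) z = derive_C v f z * g z + f z * derive_C v g z.
Proof.
move=> [f1 f2] [g1 g2] Uz; rewrite /derive_C; under eq_fun do rewrite ReM.
under [in X in _ +i* X]eq_fun do rewrite ImM.
rewrite (smooth_deriveB v (smoothM oU f1 g1) (smoothM oU f2 g2) Uz).
rewrite (smooth_deriveD v (smoothM oU f1 g2) (smoothM oU f2 g1) Uz).
rewrite (smooth_deriveM v f1 g1 Uz) (smooth_deriveM v f2 g2 Uz).
rewrite (smooth_deriveM v f1 g2 Uz) (smooth_deriveM v f2 g1 Uz).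
case: (f z) => x y; case: (g z) => x' y'.
move: ('D_v (fun w => complex.Re (f w)) z) ('D_v (fun w => complex.Im (f w)) z).
move: ('D_v (fun w => complex.Re (g w)) z) ('D_v (fun w => complex.Im (g w)) z).
move=> {f1 f2 g1 g2} a b c d.
by apply: complex_ext; rewrite /=; ring.
Qed.

Lemma derive_CJ v f z : csmooth f -> U z ->
  derive_C v (fun w => (f w)^*%R) z = (derive_C v f z)^*%R.
Proof.
move=> [f1 f2] Uz; rewrite /derive_C; under eq_fun do rewrite ReJ.
under [in X in _ +i* X]eq_fun do rewrite ImJ.
by rewrite (smooth_deriveN v f2 Uz).
Qed.

Lemma derive_CDv v w f z : csmooth f -> U z ->
  derive_C (v + w) f z = derive_C v f z + derive_C w f z.
Proof.
move=> [f1 f2] Uz; rewrite /derive_C.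
by rewrite (smooth_deriveDv oU v w f1 Uz) (smooth_deriveDv oU v w f2 Uz).
Qed.

Lemma derive_CZv (a : R) v f z : csmooth f -> U z ->
  derive_C (a *: v) f z = a%:C * derive_C v f z.
Proof.
move=> [f1 f2] Uz; rewrite /derive_C.
rewrite (smooth_deriveZv v a f1 Uz) (smooth_deriveZv v a f2 Uz).
move: ('D_v (fun w => complex.Re (f w)) z) ('D_v (fun w => complex.Im (f w)) z).
move=> {f1 f2} p q.
by apply: complex_ext; rewrite /=; ring.
Qed.

Lemma derive_CC v w f z : csmooth f -> U z ->
  derive_C v (derive_C w f) z = derive_C w (derive_C v f) z.
Proof.
move=> [f1 f2] Uz; rewrite /derive_C /=.
exact: (f_equal2 (@Complex R) (smooth_deriveC oU v w f1 Uz)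
  (smooth_deriveC oU v w f2 Uz)).
Qed.

(** The common form of [d_z], for [s = -i], and [d_zbar], for [s = i]: the rules
    of calculus are proved once for both. *)
Definition wirtinger (s : R[i]) j f z := 2^-1 * (dx j f z + s * dy j f z).

Lemma d_zE j f : d_z j f = wirtinger (- 'i) j f.
Proof. by apply/funext => z; rewrite /d_z /wirtinger mulNr. Qed.

Lemma d_zbarE j f : d_zbar j f = wirtinger 'i j f.
Proof. by []. Qed.

Lemma csmooth_wirtinger s i f : csmooth f -> csmooth (wirtinger s i f).
Proof.
move=> sf; apply: csmoothZ; apply: (csmoothD (csmooth_derive_C _ sf)).
exact: (csmoothZ s (csmooth_derive_C _ sf)).
Qed.

Lemma wirtinger_eq_on s i f g z : U z -> {in U, f =1 g} ->
  wirtinger s i f z = wirtinger s i g z.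
Proof.
move=> Uz fg; have zU : z \in U by rewrite inE.
by rewrite /wirtinger /dx /dy !(derive_C_eq_on _ fg zU).
Qed.

Lemma wirtinger_cst s i c z : wirtinger s i (fun=> c) z = 0.
Proof. by rewrite /wirtinger /dx /dy !derive_C_cst mulr0 addr0 mulr0. Qed.

Lemma wirtingerD s i f g z : csmooth f -> csmooth g -> U z ->
  wirtinger s i (fun w => f w + g w) z = wirtinger s i f z + wirtinger s i g z.
Proof.
have alg (a b c d : R[i]) :
  2^-1 * (a + b + s * (c + d)) = 2^-1 * (a + s * c) + 2^-1 * (b + s * d) by ring.
move=> sf sg Uz; rewrite /wirtinger /dx /dy !(derive_CD _ sf sg Uz).
exact: alg.
Qed.

Lemma wirtingerM s i f g z : csmooth f -> csmooth g -> U z ->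
  wirtinger s i (fun w => f w * g w) z =
  wirtinger s i f z * g z + f z * wirtinger s i g z.
Proof.
have alg (a b c d x y : R[i]) : 2^-1 * (a * y + x * b + s * (c * y + x * d)) =
  2^-1 * (a + s * c) * y + x * (2^-1 * (b + s * d)) by ring.
move=> sf sg Uz; rewrite /wirtinger /dx /dy !(derive_CM _ sf sg Uz).
exact: alg.
Qed.

Lemma wirtingerZ s i c f z : csmooth f -> U z ->
  wirtinger s i (fun w => c * f w) z = c * wirtinger s i f z.
Proof.
move=> sf Uz; rewrite (wirtingerM _ _ (csmooth_cst c) sf Uz) wirtinger_cst.
by rewrite mul0r add0r.
Qed.

Lemma wirtinger_sum s i (I : Type) (r : seq I) (F : I -> Cn R n -> R[i]) z :
  (forall k, csmooth (F k)) -> U z ->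
  wirtinger s i (fun w => \sum_(k <- r) F k w) z =
  \sum_(k <- r) wirtinger s i (F k) z.
Proof.
move=> sF Uz; elim: r => [|k r IH].
  rewrite big_nil -[RHS](wirtinger_cst s i 0 z).
  by apply: wirtinger_eq_on => // w _; rewrite big_nil.
rewrite big_cons -IH -(wirtingerD _ _ (sF k) (csmooth_sum r sF) Uz).
by apply: wirtinger_eq_on => // w _; rewrite big_cons.
Qed.

Lemma conj_i : ('i : R[i])^*%R = - 'i.
Proof. by apply: complex_ext; rewrite ?ReJ ?ImJ /= ?oppr0. Qed.

Lemma mul_ii : 'i * 'i = -1 :> R[i].
Proof. by rewrite -expr2 sqr_i. Qed.

Lemma conj_half : (2^-1 : R[i])^*%R = 2^-1.
Proof. by rewrite fmorphV rmorph_nat. Qed.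

Lemma wirtingerJ s i f z : csmooth f -> U z ->
  wirtinger s i (fun w => (f w)^*%R) z = (wirtinger (s^*%R) i f z)^*%R.
Proof.
move=> sf Uz; rewrite /wirtinger /dx /dy !(derive_CJ _ sf Uz).
by rewrite rmorphM rmorphD rmorphM /= conj_half conjCK.
Qed.

Lemma derive_C_wirtinger v s j f z : csmooth f -> U z ->
  derive_C v (wirtinger s j f) z =
  2^-1 * (derive_C v (dx j f) z + s * derive_C v (dy j f) z).
Proof.
move=> sf Uz.
have sx := csmooth_derive_C (delta_mx 0 j, 0) sf.
have sy := csmooth_derive_C (0, delta_mx 0 j) sf.
have E c g : csmooth g -> derive_C v (fun w => c * g w) z = c * derive_C v g z.
  move=> sg; rewrite (derive_CM _ (csmooth_cst c) sg Uz) derive_C_cst.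
  by rewrite mul0r add0r.
rewrite (E _ _ (csmoothD sx (csmoothZ s sy))).
by rewrite (derive_CD _ sx (csmoothZ s sy) Uz) (E _ _ sy).
Qed.

Lemma wirtingerC s t i j f z : csmooth f -> U z ->
  wirtinger s i (wirtinger t j f) z = wirtinger t j (wirtinger s i f) z.
Proof.
have alg (a b c d : R[i]) : 2^-1 * (2^-1 * (a + t * b) + s * (2^-1 * (c + t * d)))
  = 2^-1 * (2^-1 * (a + s * c) + t * (2^-1 * (b + s * d))) by ring.
move=> sf Uz.
have E s' t' i' j' : wirtinger s' i' (wirtinger t' j' f) z =
    2^-1 * (2^-1 * (dx i' (dx j' f) z + t' * dx i' (dy j' f) z) +
            s' * (2^-1 * (dy i' (dx j' f) z + t' * dy i' (dy j' f) z))).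
  by rewrite /(wirtinger s') /(dx i') /(dy i') !(derive_C_wirtinger _ _ _ sf Uz).
rewrite !E /dx /dy (derive_CC (delta_mx 0 i, 0) (delta_mx 0 j, 0) sf Uz).
rewrite (derive_CC (delta_mx 0 i, 0) (0, delta_mx 0 j) sf Uz).
rewrite (derive_CC (0, delta_mx 0 i) (delta_mx 0 j, 0) sf Uz).
rewrite (derive_CC (0, delta_mx 0 i) (0, delta_mx 0 j) sf Uz).
exact: alg.
Qed.

Lemma csmooth_d_z i f : csmooth f -> csmooth (d_z i f).
Proof. by rewrite d_zE; exact: csmooth_wirtinger. Qed.

Lemma csmooth_d_zbar i f : csmooth f -> csmooth (d_zbar i f).
Proof. by rewrite d_zbarE; exact: csmooth_wirtinger. Qed.

Lemma d_z_eq_on i f g z : U z -> {in U, f =1 g} -> d_z i f z = d_z i g z.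
Proof. by rewrite !d_zE; exact: wirtinger_eq_on. Qed.

Lemma d_zbar_eq_on i f g z : U z -> {in U, f =1 g} -> d_zbar i f z = d_zbar i g z.
Proof. by rewrite !d_zbarE; exact: wirtinger_eq_on. Qed.

Lemma d_z_cst i c z : d_z i (fun=> c) z = 0.
Proof. by rewrite d_zE; exact: wirtinger_cst. Qed.

Lemma d_zbar_cst i c z : d_zbar i (fun=> c) z = 0.
Proof. by rewrite !d_zbarE; exact: wirtinger_cst. Qed.

Lemma d_zD i f g z : csmooth f -> csmooth g -> U z ->
  d_z i (fun w => f w + g w) z = d_z i f z + d_z i g z.
Proof. by rewrite !d_zE; exact: wirtingerD. Qed.

Lemma d_zbarD i f g z : csmooth f -> csmooth g -> U z ->
  d_zbar i (fun w => f w + g w) z = d_zbar i f z + d_zbar i g z.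
Proof. by rewrite !d_zbarE; exact: wirtingerD. Qed.

Lemma d_zM i f g z : csmooth f -> csmooth g -> U z ->
  d_z i (fun w => f w * g w) z = d_z i f z * g z + f z * d_z i g z.
Proof. by rewrite !d_zE; exact: wirtingerM. Qed.

Lemma d_zbarM i f g z : csmooth f -> csmooth g -> U z ->
  d_zbar i (fun w => f w * g w) z = d_zbar i f z * g z + f z * d_zbar i g z.
Proof. by rewrite !d_zbarE; exact: wirtingerM. Qed.

Lemma d_zZ i c f z : csmooth f -> U z ->
  d_z i (fun w => c * f w) z = c * d_z i f z.
Proof. by rewrite !d_zE; exact: wirtingerZ. Qed.

Lemma d_zbarZ i c f z : csmooth f -> U z ->
  d_zbar i (fun w => c * f w) z = c * d_zbar i f z.
Proof. by rewrite !d_zbarE; exact: wirtingerZ. Qed.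

Lemma d_z_sum i (I : Type) (r : seq I) (F : I -> Cn R n -> R[i]) z :
  (forall k, csmooth (F k)) -> U z ->
  d_z i (fun w => \sum_(k <- r) F k w) z = \sum_(k <- r) d_z i (F k) z.
Proof.
move=> sF Uz; under eq_bigr do rewrite d_zE.
by rewrite d_zE; exact: wirtinger_sum.
Qed.

Lemma d_zbar_sum i (I : Type) (r : seq I) (F : I -> Cn R n -> R[i]) z :
  (forall k, csmooth (F k)) -> U z ->
  d_zbar i (fun w => \sum_(k <- r) F k w) z = \sum_(k <- r) d_zbar i (F k) z.
Proof.
move=> sF Uz; under eq_bigr do rewrite d_zbarE.
by rewrite d_zbarE; exact: wirtinger_sum.
Qed.

Lemma d_zbarJ i f z : csmooth f -> U z ->
  d_zbar i (fun w => (f w)^*%R) z = (d_z i f z)^*%R.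
Proof. by move=> sf Uz; rewrite d_zbarE (wirtingerJ _ _ sf Uz) conj_i -d_zE. Qed.

Lemma d_zJ i f z : csmooth f -> U z ->
  d_z i (fun w => (f w)^*%R) z = (d_zbar i f z)^*%R.
Proof.
by move=> sf Uz; rewrite d_zE (wirtingerJ _ _ sf Uz) rmorphN /= conj_i opprK -d_zbarE.
Qed.

Lemma d_z_zbarC i j f z : csmooth f -> U z ->
  d_z i (d_zbar j f) z = d_zbar j (d_z i f) z.
Proof. by rewrite !d_zE !d_zbarE; exact: wirtingerC. Qed.

Lemma d_zC i j f z : csmooth f -> U z -> d_z i (d_z j f) z = d_z j (d_z i f) z.
Proof. by rewrite !d_zE; exact: wirtingerC. Qed.

End ComplexSmooth.

Section VectorExpansion.
Context {R : realType} {n : nat}.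
Implicit Types (z v w : Cn R n) (i j k : 'I_n) (f : Cn R n -> R[i]) (e : 'I_n -> R[i]).
Variable U : set (Cn R n).
Hypothesis oU : open U.

(** The real vector that corresponds to the complex vector [e]. *)
Definition cvec e : Cn R n :=
  (\row_i complex.Re (e i), \row_i complex.Im (e i)).

Definition dir_z e f z := \sum_i e i * d_z i f z.
Definition dir_zbar e f z := \sum_i (e i)^*%R * d_zbar i f z.

(** Decomposition of a real directional derivative into its (1,0) and (0,1)
    parts. *)
Lemma derive_C_cvec e f z : csmooth U f -> U z ->
  derive_C (cvec e) f z = dir_z e f z + dir_zbar e f z.
Proof.
move=> sf Uz.
have dsum (F : 'I_n -> Cn R n) (r : seq 'I_n) :
    derive_C (\sum_(i <- r) F i) f z = \sum_(i <- r) derive_C (F i) f z.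
  elim: r => [|i r IH]; last by rewrite !big_cons (derive_CDv oU _ _ sf Uz) IH.
  by rewrite !big_nil /derive_C !derive0.
have -> : cvec e = \sum_i (complex.Re (e i) *: (delta_mx 0 i, 0) +
                           complex.Im (e i) *: (0, delta_mx 0 i)).
  apply: injective_projections; rewrite /= raddf_sum /=; apply/rowP => j.
    rewrite mxE summxE (bigD1 j) //= big1 => [|i ij].
      by rewrite !mxE !eqxx mulr1 mulr0 !addr0.
    by rewrite !mxE eqxx /= [j == i]eq_sym (negbTE ij) !mulr0 addr0.
  rewrite mxE summxE (bigD1 j) //= big1 => [|i ij].
    by rewrite !mxE !eqxx mulr1 mulr0 !addr0 add0r.
  by rewrite !mxE eqxx /= [j == i]eq_sym (negbTE ij) !mulr0 addr0.
rewrite dsum /dir_z /dir_zbar -big_split; apply: eq_bigr => i _ /=.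
rewrite (derive_CDv oU _ _ sf Uz) !(derive_CZv _ _ sf Uz) /d_z /d_zbar.
rewrite -/(dx i f z) -/(dy i f z); move: (dx i f z) (dy i f z) => a b.
have half : 2^-1 * 2 = 1 :> R[i] by rewrite mulVf // pnatr_eq0.
have alg (p q : R) : p%:C * a + q%:C * b =
    (p +i* q) * (2^-1 * (a - 'i * b)) + (p +i* q)^*%R * (2^-1 * (a + 'i * b)).
  have -> : p +i* q = p%:C + 'i * q%:C by apply: complex_ext; rewrite /=; ring.
  rewrite rmorphD rmorphM /= conj_i (conjc_real p : (p%:C)^*%R = _).
  rewrite (conjc_real q : (q%:C)^*%R = _).
  have -> : (p%:C + 'i * q%:C) * (2^-1 * (a - 'i * b)) +
      (p%:C + - 'i * q%:C) * (2^-1 * (a + 'i * b)) =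
      2^-1 * 2 * (p%:C * a - 'i * 'i * (q%:C * b)) by ring.
  by rewrite half mul_ii mul1r mulN1r opprK.
by case: (e i) => p q; exact: alg.
Qed.

Lemma csmooth_dir_z e f : csmooth U f -> csmooth U (dir_z e f).
Proof.
move=> sf.
exact: (csmooth_sum oU _ (fun i => csmoothZ oU (e i) (csmooth_d_z oU i sf))).
Qed.

Lemma csmooth_dir_zbar e f : csmooth U f -> csmooth U (dir_zbar e f).
Proof.
move=> sf.
exact: (csmooth_sum oU _ (fun i => csmoothZ oU (e i)^*%R (csmooth_d_zbar oU i sf))).
Qed.

Lemma dir_zD e f g z : csmooth U f -> csmooth U g -> U z ->
  dir_z e (fun w => f w + g w) z = dir_z e f z + dir_z e g z.
Proof.
move=> sf sg Uz; rewrite /dir_z -big_split; apply: eq_bigr => i _ /=.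
by rewrite (d_zD _ sf sg Uz) mulrDr.
Qed.

Lemma dir_zbarD e f g z : csmooth U f -> csmooth U g -> U z ->
  dir_zbar e (fun w => f w + g w) z = dir_zbar e f z + dir_zbar e g z.
Proof.
move=> sf sg Uz; rewrite /dir_zbar -big_split; apply: eq_bigr => i _ /=.
by rewrite (d_zbarD _ sf sg Uz) mulrDr.
Qed.

Lemma dir_z_zbar e f z : csmooth U f -> U z ->
  dir_z e (dir_zbar e f) z =
  \sum_i \sum_j e i * (e j)^*%R * d_z i (d_zbar j f) z.
Proof.
move=> sf Uz; apply: eq_bigr => i _.
rewrite (d_z_sum oU _ _ (fun j => csmoothZ oU (e j)^*%R (csmooth_d_zbar oU j sf)) Uz).
rewrite mulr_sumr; apply: eq_bigr => j _.
by rewrite (d_zZ oU _ _ (csmooth_d_zbar oU j sf) Uz) mulrA.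
Qed.

Lemma dir_zbar_z e f z : csmooth U f -> U z ->
  dir_zbar e (dir_z e f) z = dir_z e (dir_zbar e f) z.
Proof.
move=> sf Uz; rewrite (dir_z_zbar e sf Uz) exchange_big; apply: eq_bigr => j _ /=.
rewrite (d_zbar_sum oU _ _ (fun i => csmoothZ oU (e i) (csmooth_d_z oU i sf)) Uz).
rewrite mulr_sumr; apply: eq_bigr => i _.
rewrite (d_zbarZ oU _ _ (csmooth_d_z oU i sf) Uz) (d_z_zbarC oU _ _ sf Uz).
by rewrite mulrCA mulrA.
Qed.

(** The complex Hessian in the direction [e] is the Laplacian along the real
    plane spanned by [e] and [i e]: the (2,0) and (0,2) parts cancel. This is
    how a real second derivative test controls the complex Hessian. *)
Lemma derive_C2_plane e f z : csmooth U f -> U z ->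
  derive_C (cvec e) (derive_C (cvec e) f) z +
  derive_C (cvec (fun i => 'i * e i)) (derive_C (cvec (fun i => 'i * e i)) f) z =
  4 * \sum_i \sum_j e i * (e j)^*%R * d_z i (d_zbar j f) z.
Proof.
move=> sf Uz; rewrite -(dir_z_zbar e sf Uz).
set ie := fun i => 'i * e i.
have E e' : derive_C (cvec e') (derive_C (cvec e') f) z =
    dir_z e' (dir_z e' f) z + 2 * dir_z e' (dir_zbar e' f) z +
    dir_zbar e' (dir_zbar e' f) z.
  rewrite (derive_C_cvec _ (csmooth_derive_C _ sf) Uz).
  have fE : {in U, derive_C (cvec e') f =1 (fun w => dir_z e' f w + dir_zbar e' f w)}.
    by move=> w; rewrite inE => Uw; exact: derive_C_cvec.
  have -> : dir_z e' (derive_C (cvec e') f) z =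
      dir_z e' (fun w => dir_z e' f w + dir_zbar e' f w) z.
    by apply: eq_bigr => i _; rewrite (d_z_eq_on oU _ Uz fE).
  have -> : dir_zbar e' (derive_C (cvec e') f) z =
      dir_zbar e' (fun w => dir_z e' f w + dir_zbar e' f w) z.
    by apply: eq_bigr => i _; rewrite (d_zbar_eq_on oU _ Uz fE).
  have s1 := csmooth_dir_z e' sf; have s2 := csmooth_dir_zbar e' sf.
  rewrite (dir_zD _ s1 s2 Uz) (dir_zbarD _ s1 s2 Uz) (dir_zbar_z _ sf Uz).
  by rewrite [2 * _]mulr_natl mulr2n !addrA.
have zi g w : csmooth U g -> U w -> dir_z ie g w = 'i * dir_z e g w.
  by move=> sg Uw; rewrite /dir_z mulr_sumr; apply: eq_bigr => i _; rewrite [RHS]mulrA.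
have zbi g w : csmooth U g -> U w -> dir_zbar ie g w = - 'i * dir_zbar e g w.
  move=> sg Uw; rewrite /dir_zbar mulr_sumr; apply: eq_bigr => i _.
  by rewrite rmorphM /= conj_i [RHS]mulrA.
have s1 := csmooth_dir_z e sf; have s2 := csmooth_dir_zbar e sf.
have s1' := csmooth_dir_z ie sf; have s2' := csmooth_dir_zbar ie sf.
have F1 : dir_z ie (dir_z ie f) z = 'i * ('i * dir_z e (dir_z e f) z).
  rewrite (zi _ _ s1' Uz); congr (_ * _); rewrite /dir_z mulr_sumr.
  apply: eq_bigr => k _; rewrite [RHS]mulrCA; congr (_ * _).
  rewrite -(d_zZ oU _ _ s1 Uz); apply: (d_z_eq_on oU _ Uz) => w.
  by rewrite inE => Uw; exact: zi.
have F2 : dir_z ie (dir_zbar ie f) z = 'i * (- 'i * dir_z e (dir_zbar e f) z).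
  rewrite (zi _ _ s2' Uz); congr (_ * _); rewrite /dir_z mulr_sumr.
  apply: eq_bigr => k _; rewrite [RHS]mulrCA; congr (_ * _).
  rewrite -(d_zZ oU _ _ s2 Uz); apply: (d_z_eq_on oU _ Uz) => w.
  by rewrite inE => Uw; exact: zbi.
have F3 : dir_zbar ie (dir_zbar ie f) z = - 'i * (- 'i * dir_zbar e (dir_zbar e f) z).
  rewrite (zbi _ _ s2' Uz); congr (_ * _); rewrite /dir_zbar mulr_sumr.
  apply: eq_bigr => k _; rewrite [RHS]mulrCA; congr (_ * _).
  rewrite -(d_zbarZ oU _ _ s2 Uz); apply: (d_zbar_eq_on oU _ Uz) => w.
  by rewrite inE => Uw; exact: zbi.
have ii x : 'i * ('i * x) = - x :> R[i] by rewrite mulrA mul_ii mulN1r.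
have F2' : 'i * (- 'i * dir_z e (dir_zbar e f) z) = dir_z e (dir_zbar e f) z.
  by rewrite mulNr mulrN ii opprK.
have F3' : - 'i * (- 'i * dir_zbar e (dir_zbar e f) z) =
    - dir_zbar e (dir_zbar e f) z.
  by rewrite !mulNr mulrN opprK ii.
rewrite !E F1 ii F2 F2' F3 F3'.
move: (dir_z e (dir_z e f) z) (dir_z e (dir_zbar e f) z).
by move: (dir_zbar e (dir_zbar e f) z) => a b c; ring.
Qed.

End VectorExpansion.

(** * Positive definite Hermitian matrices *)

Section HermitianForms.
Context {R : realType} {n : nat}.
Local Notation C := R[i].
Implicit Types (A B E : 'M[C]_n).

Definition sqn (x : C) : R := complex.Re x ^+ 2 + complex.Im x ^+ 2.

Lemma mulJ (x : C) : x * x^*%R = (sqn x)%:C.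
Proof.
by apply: complex_ext; rewrite !(ReM, ImM, ReJ, ImJ) /sqn /=; ring.
Qed.

Lemma sqn_ge0 x : 0 <= sqn x.
Proof. by rewrite addr_ge0 // sqr_ge0. Qed.

Lemma sqn_gt0 x : x != 0 -> 0 < sqn x.
Proof.
case: x => a b ab0; rewrite /sqn /= lt0r paddr_eq0 ?sqr_ge0 // !sqrf_eq0.
rewrite addr_ge0 ?sqr_ge0 // andbT; apply: contra ab0 => /andP[/eqP-> /eqP->].
by [].
Qed.

Lemma sqnM x y : sqn (x * y) = sqn x * sqn y.
Proof. by case: x => a b; case: y => c d; rewrite /sqn /=; ring. Qed.

Lemma sqnJ x : sqn (x^*%R) = sqn x.
Proof. by rewrite /sqn ReJ ImJ sqrrN. Qed.

Definition hquad A (v : 'rV[C]_n) : C := \sum_i \sum_j A i j * v 0 i * (v 0 j)^*%R.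

Lemma hquadE A v : hquad A v = (v *m A *m (map_mx Num.conj v)^T) 0 0.
Proof.
rewrite mxE /hquad exchange_big; apply: eq_bigr => j _.
rewrite !mxE mulr_suml; by apply: eq_bigr => i _; rewrite [v 0 i * _]mulrC.
Qed.

Definition ctr m p (M : 'M[C]_(m, p)) : 'M[C]_(p, m) := (map_mx Num.conj M)^T.

Lemma ctrE m p (M : 'M[C]_(m, p)) i j : ctr M i j = (M j i)^*%R.
Proof. by rewrite !mxE. Qed.

Lemma ctrK m p (M : 'M[C]_(m, p)) : ctr (ctr M) = M.
Proof. by apply/matrixP => i j; rewrite !ctrE conjCK. Qed.

Lemma ctr_mul m p q (M : 'M[C]_(m, p)) (N : 'M[C]_(p, q)) :
  ctr (M *m N) = ctr N *m ctr M.
Proof. by rewrite /ctr map_mxM trmx_mul. Qed.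

Lemma det_ctr A : \det (ctr A) = (\det A)^*%R.
Proof. by rewrite /ctr det_tr det_map_mx. Qed.

Lemma hermsymmxE A : (A \is hermsymmx) = (A == ctr A).
Proof. by rewrite qualifE /= expr0 scale1r /ctr map_trmx. Qed.

Lemma posdef_congr A B : B \in unitmx -> posdefmx A -> posdefmx (B *m A *m ctr B).
Proof.
move=> uB [hA pA]; split.
  rewrite hermsymmxE !ctr_mul ctrK mulmxA.
  by move: hA; rewrite hermsymmxE => /eqP <-.
move=> v v0; rewrite -/(hquad _ v) hquadE.
have -> : v *m (B *m A *m ctr B) *m (map_mx Num.conj v)^T =
    (v *m B) *m A *m (map_mx Num.conj (v *m B))^T.
  by rewrite -!/(ctr _) ctr_mul !mulmxA.
rewrite -hquadE; apply: pA; apply: contra v0 => /eqP vB.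
by rewrite -[v](mulmxK uB) vB mul0mx.
Qed.

(** The spectral theorem for normal matrices; an eigenvalue is the value of
    the form on a unit eigenvector, hence positive. *)
Lemma posdef_spectral A : posdefmx A ->
  exists (P : 'M[C]_n) (d : 'I_n -> R), [/\ P *m ctr P = 1%:M,
    A = ctr P *m diag_mx (\row_a (d a)%:C) *m P & forall a, 0 < d a].
Proof.
move=> [hA pA].
have hA' : A \is hermsymmx by [].
move/hermitian_normalmx/orthomx_spectralP: hA => AE.
have uP := spectral_unitarymx A; set P := spectralmx A in AE uP *.
have PP : P *m ctr P = 1%:M by apply/eqP; move: uP; rewrite qualifE /ctr map_trmx.
have iP : invmx P = ctr P by rewrite invmx_unitary // /ctr map_trmx.
set D := spectral_diag A in AE; rewrite iP in AE.
have DE : diag_mx D = P *m A *m ctr P.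
  by rewrite AE !mulmxA PP mul1mx -mulmxA PP mulmx1.
have Dpos a : 0 < D 0 a.
  have -> : D 0 a = hquad A (row a P).
    have /matrixP/(_ a a) := DE; rewrite mxE eqxx mulr1n => ->.
    rewrite hquadE -!row_mul !mxE; apply: eq_bigr => j _.
    by rewrite !mxE.
  apply: pA; apply/eqP => r0.
  have /matrixP/(_ a a) := PP; rewrite mxE mxE eqxx big1 => [/eqP|j _].
    by rewrite eq_sym oner_eq0.
  by have /matrixP/(_ 0 j) := r0; rewrite !mxE => ->; rewrite mul0r.
exists P, (fun a => complex.Re (D 0 a)); split; first exact: PP.
  rewrite {1}AE; congr (_ *m diag_mx _ *m _); apply/rowP => a; rewrite !mxE.
  by rewrite RRe_real // gtr0_real.
by move=> a; have := Dpos a; rewrite ltcE => /andP[].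
Qed.

(** Rescaling the eigenvectors by the inverse square roots of the eigenvalues
    gives a frame that is unitary for [A]. *)
Lemma posdef_factor A : posdefmx A ->
  exists E : 'M[C]_n, E \in unitmx /\ E *m A *m ctr E = 1%:M.
Proof.
move=> /posdef_spectral[P [d [PP AE d0]]].
pose S := diag_mx (\row_a ((Num.sqrt (d a))^-1)%:C).
have SE : S *m diag_mx (\row_a (d a)%:C) *m S = 1%:M.
  rewrite /S !mulmx_diag; apply/matrixP => i j; rewrite !mxE.
  case: eqVneq => [_|_]; last by rewrite mulr0n.
  rewrite !mulr1n -!rmorphM /=; set r := Num.sqrt (d i).
  have r0 : r != 0 by rewrite gt_eqF // sqrtr_gt0.
  have dE : d i = r * r by rewrite -expr2 sqr_sqrtr // ltW.
  have -> : r^-1 * d i * r^-1 = 1 by rewrite dE mulKf // divff.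
  by [].
have cS : ctr S = S.
  apply/matrixP => i j; rewrite ctrE !mxE eq_sym; case: eqVneq => [->|_].
    by rewrite !mulr1n; exact: conjc_real.
  by rewrite !mulr0n rmorph0.
have EA : (S *m P) *m A *m ctr (S *m P) = 1%:M.
  rewrite ctr_mul cS AE !mulmxA -(mulmxA S P) PP mulmx1.
  by rewrite -[X in X *m _ = _]mulmxA PP mulmx1.
exists (S *m P); split => //.
move: (S *m P) EA => Q EA; rewrite unitmxE unitfE; apply/eqP => Q0.
have := congr1 determinant EA; rewrite det1 !det_mulmx Q0 !mul0r => /esym/eqP.
by rewrite oner_eq0.
Qed.

Lemma posdef_det A : posdefmx A -> exists2 d : R, 0 < d & \det A = d%:C.
Proof.
move=> /posdef_spectral[P [d [PP AE d0]]]; exists (\prod_a d a).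
  by apply: prodr_gt0.
have PP' : ctr P *m P = 1%:M by apply: mulmx1C.
rewrite AE !det_mulmx mulrAC -det_mulmx PP' det1 mul1r det_diag rmorph_prod.
by apply: eq_bigr => a _; rewrite mxE.
Qed.

(** Concavity of the logarithm, [ln d <= d - 1], applied to every eigenvalue. *)
Lemma posdef_ln_det A : posdefmx A ->
  ln (complex.Re (\det A)) <= complex.Re (\tr A) - n%:R.
Proof.
move=> /posdef_spectral[P [d [PP AE d0]]].
have PP' : ctr P *m P = 1%:M by apply: mulmx1C.
have -> : \det A = (\prod_a d a)%:C.
  rewrite AE !det_mulmx mulrAC -det_mulmx PP' det1 mul1r det_diag rmorph_prod.
  by apply: eq_bigr => a _; rewrite mxE.
have -> : \tr A = (\sum_a d a)%:C.
  rewrite AE -mulmxA mxtrace_mulC -mulmxA PP mulmx1 mxtrace_diag rmorph_sum.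
  by apply: eq_bigr => a _; rewrite mxE.
rewrite /=; have -> : n%:R = \sum_(a < n) (1 : R) by rewrite sumr_const card_ord.
rewrite -sumrB.
have : \prod_a d a > 0 /\ ln (\prod_a d a) <= \sum_a (d a - 1).
  elim/big_rec2: _ => [|a x y _ [y0 IH]]; first by rewrite ln1 ltr01.
  split; first by rewrite mulr_gt0.
  rewrite lnM ?posrE //; apply: lerD => //.
  have := @le_ln1Dx R (d a - 1); rewrite [1 + _]addrC subrK; apply.
  by rewrite ltrBDl subrr.
by case.
Qed.

Lemma det_congr A B : \det (B *m A *m ctr B) = (sqn (\det B))%:C * \det A.
Proof. by rewrite !det_mulmx det_ctr -mulJ mulrAC. Qed.

Lemma posdef_ln_det_congr A B : B \in unitmx -> posdefmx A ->
  ln (complex.Re (\det A)) + ln (sqn (\det B)) <=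
  complex.Re (\tr (B *m A *m ctr B)) - n%:R.
Proof.
move=> uB pA; have := posdef_ln_det (posdef_congr uB pA); rewrite det_congr.
have [d d0 ->] := posdef_det pA; rewrite -rmorphM /= lnM ?posrE //.
  by rewrite addrC.
by apply: sqn_gt0; rewrite unitmxE unitfE in uB.
Qed.

Lemma ln_det_congr1 A B : B *m A *m ctr B = 1%:M -> posdefmx A -> B \in unitmx ->
  ln (complex.Re (\det A)) + ln (sqn (\det B)) = 0.
Proof.
move=> BE pA uB; have := congr1 determinant BE; rewrite det_congr det1.
have [d d0 ->] := posdef_det pA; rewrite -rmorphM => /complexI dE.
rewrite /= -lnM ?posrE // 1?mulrC ?dE ?ln1 //.
by apply: sqn_gt0; rewrite unitmxE unitfE in uB.
Qed.

(** The matrix differs from the identity in column [k] only, so the cofactors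
    along that column are those of the identity. *)
Lemma det_add_col (x : 'I_n -> C) (k : 'I_n) (c : C) :
  \det (1%:M + c *: (\matrix_(i, j) (x i *+ (j == k)))) = 1 + c * x k.
Proof.
set A := _ + _; rewrite (expand_det_col _ k).
have cof i : cofactor A i k = (i == k)%:R.
  have -> : cofactor A i k = cofactor 1%:M i k.
    rewrite /cofactor; congr (_ * \det _); apply/matrixP => a b; rewrite !mxE.
    by rewrite [lift k b == k]eq_sym (negbTE (neq_lift _ _)) mulr0n mulr0 addr0.
  have := mul_mx_adj (1%:M : 'M[C]_n); rewrite det1 mul1mx => /matrixP/(_ k i).
  by rewrite !mxE eq_sym.
under eq_bigr do rewrite cof.
rewrite (bigD1 k) //= big1 => [|i ik]; last by rewrite (negbTE ik) mulr0.
by rewrite !mxE !eqxx !mulr1n mulr1 addr0.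
Qed.

(** The Cauchy-Schwarz inequality, by expanding [\sum_i |X e_i - s
    conj(x_i)|^2 >= 0]. *)
Lemma csum_CS (e x : 'I_n -> C) :
  sqn (\sum_i e i * x i) <= (\sum_i sqn (e i)) * (\sum_i sqn (x i)).
Proof.
set s := \sum_i e i * x i; set Y := \sum_i sqn (e i); set X := \sum_i sqn (x i).
have X0 : 0 <= X by apply: sumr_ge0 => i _; exact: sqn_ge0.
have := X0; rewrite le_eqVlt => /predU1P[X00|Xgt].
  have -> : s = 0.
    rewrite /s big1 // => i _; have [->|xi] := eqVneq (x i) 0; first by rewrite mulr0.
    have := sqn_gt0 xi; rewrite lt_neqAle => /andP[/eqP[]]; apply/esym/eqP.
    move/esym/eqP: X00; rewrite psumr_eq0 => [/allP/(_ i)|j _]; last exact: sqn_ge0.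
    by rewrite mem_index_enum => /(_ isT).
  by rewrite /sqn /= expr0n addr0 mulr_ge0 // /Y sumr_ge0 // => i _; exact: sqn_ge0.
have key : 0 <= \sum_i sqn (X%:C * e i - s * (x i)^*%R).
  by apply: sumr_ge0 => i _; exact: sqn_ge0.
have E i : sqn (X%:C * e i - s * (x i)^*%R) =
    X ^+ 2 * sqn (e i) + (- 2 * X) * complex.Re (s^*%R * (e i * x i)) +
    sqn s * sqn (x i).
  have gen (p q t : C) : sqn (X%:C * p - t * q^*%R) =
      X ^+ 2 * sqn p + (- 2 * X) * complex.Re (t^*%R * (p * q)) + sqn t * sqn q.
    case: p q t => [a b] [c d] [p q].
    by rewrite /sqn !(ReD, ImD, ReM, ImM, ReJ, ImJ) /=; ring.
  exact: gen.
move: key; rewrite (eq_bigr _ (fun i _ => E i)) !big_split /= -!mulr_sumr.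
rewrite -Re_sum -mulr_sumr -/s -/X -/Y [s^*%R * s]mulrC mulJ /= => key.
rewrite -(ler_pM2l Xgt); apply: le_trans (_ : _ <= X ^+ 2 * Y) _.
  rewrite -subr_ge0; apply: le_trans key _; rewrite le_eqVlt; apply/orP; left.
  by apply/eqP; ring.
by rewrite expr2 -mulrA [Y * X]mulrC.
Qed.

(** With [A = B B^*], both sides are sums over the columns of [B], compared by
    Cauchy-Schwarz. *)
Lemma posdef_le_trace A (v : 'rV[C]_n) : posdefmx A ->
  complex.Re (hquad A v) <= complex.Re (\tr A) * \sum_i sqn (v 0 i).
Proof.
move=> /posdef_factor[E [uE EA]].
have AE : A = invmx E *m ctr (invmx E).
  have := congr1 (fun M => invmx E *m M *m ctr (invmx E)) EA.
  rewrite mulmx1 -!mulmxA -ctr_mul mulVmx // => <-.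
  by rewrite mulmxA mulVmx // mul1mx /ctr map_mx1 trmx1 mulmx1.
set B := invmx E in AE.
have -> : \tr A = (\sum_a \sum_i sqn (B i a))%:C.
  rewrite exchange_big rmorph_sum; apply: eq_bigr => i _.
  rewrite AE mxE rmorph_sum; apply: eq_bigr => a _.
  by rewrite ctrE mulJ.
have -> : hquad A v = (\sum_a sqn (\sum_i v 0 i * B i a))%:C.
  rewrite hquadE AE -/(ctr v) mulmxA -mulmxA -ctr_mul mxE rmorph_sum.
  apply: eq_bigr => a _; rewrite ctrE mulJ mxE; congr (sqn _)%:C.
rewrite /= mulr_suml; apply: ler_sum => a _; rewrite mulrC.
exact: csum_CS.
Qed.

End HermitianForms.

(** * The Hopf metric on the punctured space *)

Section Coordinates.
Context {R : realType} {n : nat}.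
Implicit Types (z v w : Cn R n) (i j k : 'I_n).

Definition punctured : set (Cn R n) := [set z | z != 0].

Lemma open_punctured : open punctured.
Proof.
rewrite (_ : punctured = ~` [set 0]).
  apply: closed_openC; apply: accessible_closed_set1.
  by apply: hausdorff_accessible; exact: norm_hausdorff.
by rewrite eqEsubset; split => z /=; [move/eqP|move=> h; apply/eqP].
Qed.

Variable U : set (Cn R n).
Hypothesis oU : open U.

Lemma derive_C_zcoord v j z : derive_C v (fun w => zcoord w j) z = zcoord v j.
Proof.
rewrite /derive_C /zcoord /=.
have E1 (h : R) v' x : (h *: v' + x : Cn R n).1 0 j = h * v'.1 0 j + x.1 0 j.
  by rewrite /= !mxE.
have E2 (h : R) v' x : (h *: v' + x : Cn R n).2 0 j = h * v'.2 0 j + x.2 0 j.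
  by rewrite /= !mxE.
have [_ ->] := is_derive_linear E1 v z.
by have [_ ->] := is_derive_linear E2 v z.
Qed.

Lemma csmooth_zcoord j : csmooth U (fun z => zcoord z j).
Proof.
split; apply: smooth_linear => //.
- by move=> h v x /=; rewrite !mxE.
- move=> z; apply: (@continuous_comp _ _ _ fst (fun M : 'rV[R]_n => M 0 j)).
    exact: cvg_fst.
  exact: coord_continuous.
- by move=> h v x /=; rewrite !mxE.
- move=> z; apply: (@continuous_comp _ _ _ snd (fun M : 'rV[R]_n => M 0 j)).
    exact: cvg_snd.
  exact: coord_continuous.
Qed.

Lemma wirtinger_zcoord s i j z :
  wirtinger s i (fun w => zcoord w j) z = 2^-1 * (1 + s * 'i) *+ (j == i).
Proof.
rewrite /wirtinger /dx /dy !derive_C_zcoord /zcoord /= !mxE eqxx /=.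
case: (j == i); last first.
  by rewrite /= mulr0n -[0 +i* 0]/(0 : R[i]) mulr0 addr0 mulr0.
by rewrite mulr1n.
Qed.

Lemma d_z_zcoord i j z : d_z i (fun w => zcoord w j) z = (j == i)%:R.
Proof.
rewrite d_zE wirtinger_zcoord mulNr mul_ii opprK.
by rewrite -[1 + 1]/(2 : R[i]) mulVf // pnatr_eq0.
Qed.

Lemma d_zbar_zcoord i j z : d_zbar i (fun w => zcoord w j) z = 0.
Proof. by rewrite d_zbarE wirtinger_zcoord mul_ii subrr mulr0 mul0rn. Qed.

Lemma d_z_zcoordJ i j z : U z -> d_z i (fun w => (zcoord w j)^*%R) z = 0.
Proof.
by move=> Uz; rewrite (d_zJ _ (csmooth_zcoord j) Uz) d_zbar_zcoord rmorph0.
Qed.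

Lemma d_zbar_zcoordJ i j z : U z ->
  d_zbar i (fun w => (zcoord w j)^*%R) z = (j == i)%:R.
Proof.
by move=> Uz; rewrite (d_zbarJ _ (csmooth_zcoord j) Uz) d_z_zcoord rmorph_nat.
Qed.

Definition nsq z : R := \sum_j sqn (zcoord z j).

Lemma nsqE z : (nsq z)%:C = \sum_j zcoord z j * (zcoord z j)^*%R.
Proof. by rewrite rmorph_sum; apply: eq_bigr => j _; rewrite mulJ. Qed.

Lemma nsq_ge0 z : 0 <= nsq z.
Proof. by apply: sumr_ge0 => j _; exact: sqn_ge0. Qed.

Lemma zcoord_inj z w : (forall j, zcoord z j = zcoord w j) -> z = w.
Proof.
case: z => a b; case: w => c d h.
by congr pair; apply/rowP => j; have := h j; rewrite /zcoord /= => -[].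
Qed.

Lemma nsq_gt0 z : z != 0 -> 0 < nsq z.
Proof.
move=> z0; rewrite lt_neqAle nsq_ge0 andbT eq_sym; apply: contra z0.
rewrite psumr_eq0 => [/allP h|j _]; last exact: sqn_ge0.
apply/eqP; apply: zcoord_inj => j; rewrite [RHS]/zcoord /= !mxE; apply/eqP.
apply: contraT => zj.
have := h j; rewrite mem_index_enum => /(_ isT).
by rewrite gt_eqF // sqn_gt0.
Qed.

Lemma csmooth_nsq : csmooth U (fun z => (nsq z)%:C).
Proof.
apply: (csmooth_eq_on oU _ (csmooth_sum oU (index_enum _) (fun j =>
  csmoothM oU (csmooth_zcoord j) (csmoothJ oU (csmooth_zcoord j))))) => z _.
by rewrite nsqE.
Qed.

Lemma d_z_nsq i z : U z -> d_z i (fun w => (nsq w)%:C) z = (zcoord z i)^*%R.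
Proof.
move=> Uz; pose F j w := zcoord w j * (zcoord w j)^*%R : R[i].
have sF j : csmooth U (F j).
  exact: (csmoothM oU (csmooth_zcoord j) (csmoothJ oU (csmooth_zcoord j))).
have -> : (fun w => (nsq w)%:C) = (fun w => \sum_j F j w).
  by apply/funext => w; rewrite nsqE.
rewrite (d_z_sum oU _ _ sF Uz) (bigD1 i) //= big1 => [|j ji].
  rewrite (d_zM oU _ (csmooth_zcoord i) (csmoothJ oU (csmooth_zcoord i)) Uz).
  by rewrite d_z_zcoord d_z_zcoordJ // eqxx mulr0 !addr0 mul1r.
rewrite (d_zM oU _ (csmooth_zcoord j) (csmoothJ oU (csmooth_zcoord j)) Uz).
by rewrite d_z_zcoord d_z_zcoordJ // (negbTE ji) mulr0 !addr0 mul0r.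
Qed.

Lemma d_zbar_nsq i z : U z -> d_zbar i (fun w => (nsq w)%:C) z = zcoord z i.
Proof.
move=> Uz; rewrite -[RHS]conjCK -(d_z_nsq i Uz) -(d_zbarJ _ csmooth_nsq Uz).
by apply: (d_zbar_eq_on oU _ Uz) => w _; rewrite [RHS]conjc_real.
Qed.

End Coordinates.

Section InverseNsq.
Context {R : realType} {n : nat}.
Implicit Types (z v w : Cn R n) (i j k : 'I_n).
Local Notation U := (@punctured R n).
Local Notation oU := (@open_punctured R n).

Definition insq z : R[i] := (nsq z)^-1%:C.

Lemma insqK z : U z -> insq z * (nsq z)%:C = 1.
Proof. by move=> z0; rewrite -rmorphM mulVf // gt_eqF // nsq_gt0. Qed.

Lemma insqJ z : (insq z)^*%R = insq z.
Proof. exact: conjc_real. Qed.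

Lemma csmooth_insq : csmooth U insq.
Proof.
apply: csmooth_real; first exact: oU.
apply: smoothV; [exact: oU|by move=> z z0; rewrite gt_eqF // nsq_gt0|].
by have [h _] := csmooth_nsq oU; exact: h.
Qed.

Lemma d_z_insq i z : U z -> d_z i insq z = - (zcoord z i)^*%R * insq z ^+ 2.
Proof.
move=> Uz.
have : d_z i (fun w => insq w * (nsq w)%:C) z = 0.
  rewrite -[RHS](d_z_cst i 1 z); apply: (d_z_eq_on oU _ Uz) => w.
  by rewrite inE; exact: insqK.
rewrite (d_zM oU _ csmooth_insq (csmooth_nsq oU) Uz) (d_z_nsq oU i Uz).
move=> /(congr1 (fun a => a * insq z)); rewrite mul0r mulrDl -mulrA.
rewrite [(nsq z)%:C * _]mulrC insqK // mulr1 => /eqP.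
by rewrite addr_eq0 => /eqP ->; ring.
Qed.

Lemma d_zbar_insq i z : U z -> d_zbar i insq z = - zcoord z i * insq z ^+ 2.
Proof.
move=> Uz; have := d_zbarJ i csmooth_insq Uz; rewrite (d_z_insq i Uz).
rewrite rmorphM rmorphN rmorphXn /= conjCK insqJ => <-.
by apply: (d_zbar_eq_on oU _ Uz) => w _; rewrite insqJ.
Qed.

Lemma omega_HE z i j : omega_H z i j = insq z *+ (i == j).
Proof.
rewrite /omega_H mxE; congr (_ *+ _); rewrite /insq fmorphV /=; congr (_^-1).
by rewrite nsqE; apply: eq_bigr => k _; rewrite -normCK.
Qed.

(** The torsion of [omega_H], whose coefficients are [insq z] times the
    identity. *)
Definition torsion_H z i k b : R[i] := insq z ^+ 2 *
  ((k == b)%:R * (zcoord z i)^*%R - (i == b)%:R * (zcoord z k)^*%R).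

Lemma torsion_omega_H i k b z : U z ->
  d_z k (fun w => omega_H w i b) z - d_z i (fun w => omega_H w k b) z =
  torsion_H z i k b.
Proof.
move=> Uz.
have E p q l : d_z l (fun w => omega_H w p q) z =
    (p == q)%:R * (- (zcoord z l)^*%R * insq z ^+ 2).
  rewrite -(d_z_insq l Uz) -(d_zZ oU _ _ csmooth_insq Uz).
  by apply: (d_z_eq_on oU _ Uz) => w _; rewrite omega_HE mulr_natl.
by rewrite !E /torsion_H; ring.
Qed.

End InverseNsq.

(** * Trace identities at a maximum *)

Section MaximumPoint.
Context {R : realType} {n : nat}.
Implicit Types (z v w : Cn R n) (i j k b : 'I_n).
Local Notation U := (@punctured R n).
Local Notation oU := (@open_punctured R n).

Lemma sum_delta (A : 'I_n -> R[i]) j : \sum_k (k == j)%:R * A k = A j.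
Proof.
rewrite (bigD1 j) //= eqxx mul1r big1 ?addr0 // => k kj.
by rewrite (negbTE kj) mul0r.
Qed.

Variable g : Cn R n -> 'M[R[i]]_n.
Hypothesis sg : forall i j, csmooth U (fun w => g w i j).
Hypothesis pg : forall z, U z -> posdefmx (g z).
Hypothesis torg : forall z, U z -> forall i k b,
  d_z k (fun w => g w i b) z - d_z i (fun w => g w k b) z = torsion_H z i k b.

(** The Euclidean trace; the trace with respect to [omega_H] is [trH] below. *)
Definition mtr z : R[i] := \sum_k g z k k.

Lemma csmooth_mtr : csmooth U mtr.
Proof. exact: (csmooth_sum oU _ (fun k => sg k k)). Qed.

Lemma metric_herm z i j : U z -> g z j i = (g z i j)^*%R.
Proof.
move=> /pg[]; rewrite hermsymmxE => /eqP/matrixP/(_ j i) -> _.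
by rewrite ctrE.
Qed.

Lemma mtrJ z : U z -> (mtr z)^*%R = mtr z.
Proof.
move=> Uz; rewrite /mtr rmorph_sum; apply: eq_bigr => k _.
exact: (esym (metric_herm k k Uz)).
Qed.

(** Contracting the torsion identity exchanges the divergence of [g] for the
    gradient of its trace. *)
Lemma contracted_torsion z i : U z ->
  \sum_k d_z k (fun w => g w i k) z =
  d_z i mtr z + (n%:R - 1) * (insq z ^+ 2 * (zcoord z i)^*%R).
Proof.
move=> Uz; rewrite (d_z_sum oU i _ (fun k => sg k k) Uz).
have E k : d_z k (fun w => g w i k) z = d_z i (fun w => g w k k) z +
    (insq z ^+ 2 * (zcoord z i)^*%R - insq z ^+ 2 * ((k == i)%:R * (zcoord z k)^*%R)).
  have := torg Uz i k k; rewrite /torsion_H eqxx mulr1n => /eqP; rewrite subr_eq => /eqP ->.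
  by rewrite [i == k]eq_sym; ring.
rewrite (eq_bigr _ (fun k _ => E k)) big_split; congr (_ + _).
rewrite sumrB sumr_const card_ord -mulr_sumr (sum_delta (fun k => (zcoord z k)^*%R)).
by rewrite -mulr_natl; ring.
Qed.

Lemma contracted_torsionJ z j : U z ->
  \sum_k d_zbar k (fun w => g w k j) z =
  d_zbar j mtr z + (n%:R - 1) * (insq z ^+ 2 * zcoord z j).
Proof.
move=> Uz; have := congr1 Num.conj (contracted_torsion j Uz).
have -> (c d : R[i]) : (c + (n%:R - 1) * (insq z ^+ 2 * d^*%R))^*%R =
    c^*%R + (n%:R - 1) * (insq z ^+ 2 * d).
  rewrite rmorphD [in X in _ + X]rmorphM rmorphB rmorph1 rmorph_nat /=.
  by rewrite [in X in _ * X]rmorphM /= conjCK rmorphXn /= insqJ.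
rewrite rmorph_sum /= -(d_zbarJ j csmooth_mtr Uz).
rewrite (d_zbar_eq_on oU j Uz (g := mtr)); last first.
  by move=> w; rewrite inE; exact: mtrJ.
move=> <-; apply: eq_bigr => k _; rewrite -(d_zbarJ k (sg j k) Uz).
by apply: (d_zbar_eq_on oU k Uz) => w; rewrite inE => Uw; rewrite -metric_herm.
Qed.

Let csmooth_insq2 : csmooth U (fun w => insq w ^+ 2 : R[i]).
Proof. exact: (csmoothM oU csmooth_insq csmooth_insq). Qed.

Lemma d_zbar_insq2 k z : U z ->
  d_zbar k (fun w => insq w ^+ 2) z = - 2 * zcoord z k * insq z ^+ 3.
Proof.
move=> Uz; rewrite (d_zbarM oU k csmooth_insq csmooth_insq Uz).
by rewrite (d_zbar_insq k Uz); ring.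
Qed.

Lemma d_z_insq2 k z : U z ->
  d_z k (fun w => insq w ^+ 2) z = - 2 * (zcoord z k)^*%R * insq z ^+ 3.
Proof.
move=> Uz; rewrite (d_zM oU k csmooth_insq csmooth_insq Uz).
by rewrite (d_z_insq k Uz); ring.
Qed.

Let tf i w : R[i] := insq w ^+ 2 * (zcoord w i)^*%R.
Let stf i : csmooth U (tf i).
Proof. exact: (csmoothM oU csmooth_insq2 (csmoothJ oU (csmooth_zcoord oU i))). Qed.

Let d_zbar_tf k i z : U z -> d_zbar k (tf i) z =
  - 2 * zcoord z k * (zcoord z i)^*%R * insq z ^+ 3 + (i == k)%:R * insq z ^+ 2.
Proof.
move=> Uz; rewrite (d_zbarM oU k csmooth_insq2 (csmoothJ oU (csmooth_zcoord oU i)) Uz).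
by rewrite (d_zbar_insq2 k Uz) (d_zbar_zcoordJ oU k i Uz); ring.
Qed.

Lemma d_zbar_torsion_H i k b z : U z ->
  d_zbar k (fun w => torsion_H w i k b) z =
  (k == b)%:R * (- 2 * zcoord z k * (zcoord z i)^*%R * insq z ^+ 3 +
                 (i == k)%:R * insq z ^+ 2) -
  (i == b)%:R * (- 2 * (zcoord z k * (zcoord z k)^*%R) * insq z ^+ 3 + insq z ^+ 2).
Proof.
move=> Uz.
have -> : d_zbar k (fun w => torsion_H w i k b) z =
    d_zbar k (fun w => (k == b)%:R * tf i w + - (i == b)%:R * tf k w) z.
  by apply: (d_zbar_eq_on oU k Uz) => w _; rewrite /torsion_H /tf; ring.
rewrite (d_zbarD k (csmoothZ oU _ (stf i)) (csmoothZ oU _ (stf k)) Uz).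
rewrite (d_zbarZ oU k _ (stf i) Uz) (d_zbarZ oU k _ (stf k) Uz).
by rewrite (d_zbar_tf k i Uz) (d_zbar_tf k k Uz) eqxx mulr1n; ring.
Qed.

Lemma csmooth_torsion_H i k b : csmooth U (fun w => torsion_H w i k b).
Proof.
apply: (csmooth_eq_on oU _ (csmoothD oU (csmoothZ oU (k == b)%:R (stf i))
  (csmoothZ oU (- (i == b)%:R) (stf k)))) => w _.
by rewrite /torsion_H /tf; ring.
Qed.

(** Exchanging the holomorphic indices, then the antiholomorphic ones, turns
    the Laplacian of [g] into the complex Hessian of its trace; the correction
    comes from the derivative of the torsion of [omega_H]. *)
Lemma contracted_curvature z i j : U z ->
  \sum_k d_z k (d_zbar k (fun w => g w i j)) z =
  d_z i (d_zbar j mtr) z + 2 * (i == j)%:R * insq z ^+ 2 -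
  2 * n%:R * ((zcoord z i)^*%R * zcoord z j * insq z ^+ 3).
Proof.
move=> Uz.
have E k : d_z k (d_zbar k (fun w => g w i j)) z =
    d_z i (d_zbar k (fun w => g w k j)) z + d_zbar k (fun w => torsion_H w i k j) z.
  rewrite (d_z_zbarC oU _ _ (sg i j) Uz) (d_z_zbarC oU _ _ (sg k j) Uz).
  rewrite -(d_zbarD k (csmooth_d_z oU i (sg k j)) (csmooth_torsion_H i k j) Uz).
  apply: (d_zbar_eq_on oU k Uz) => w; rewrite inE => Uw.
  by rewrite -(torg Uw) addrC subrK.
rewrite (eq_bigr _ (fun k _ => E k)) big_split /=.
have sk k : csmooth U (d_zbar k (fun w => g w k j)).
  exact: (csmooth_d_zbar oU k (sg k j)).
rewrite -(d_z_sum oU i _ sk Uz).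
have sz := csmoothM oU csmooth_insq2 (csmooth_zcoord oU j).
have su := csmooth_d_zbar oU j csmooth_mtr.
have -> : d_z i (fun w => \sum_k d_zbar k (fun w => g w k j) w) z =
    d_z i (fun w => d_zbar j mtr w + (n%:R - 1) * (insq w ^+ 2 * zcoord w j)) z.
  apply: (d_z_eq_on oU i Uz) => w; rewrite inE => Uw.
  exact: contracted_torsionJ.
rewrite (d_zD i su (csmoothZ oU _ sz) Uz) (d_zZ oU i _ sz Uz).
rewrite (d_zM oU i csmooth_insq2 (csmooth_zcoord oU j) Uz) (d_z_insq2 i Uz).
rewrite d_z_zcoord (eq_bigr _ (fun k _ => d_zbar_torsion_H i k j Uz)) sumrB.
rewrite (sum_delta (fun k => - 2 * zcoord z k * (zcoord z i)^*%R * insq z ^+ 3 +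
                 (i == k)%:R * insq z ^+ 2)) -mulr_sumr big_split /=.
rewrite sumr_const card_ord -mulr_suml -mulr_sumr -nsqE.
have -> : - 2 * (nsq z)%:C * insq z ^+ 3 = - 2 * insq z ^+ 2 :> R[i].
  by rewrite exprS -mulrA [(nsq z)%:C * _]mulrA [(nsq z)%:C * _]mulrC insqK // mul1r.
rewrite -[insq z ^+ 2 *+ n]mulr_natl [j == i]eq_sym.
move: (d_z i _ z) (zcoord z i)^*%R (zcoord z j) (insq z) (i == j)%:R (n%:R : R[i]).
by move=> a p q r d m; ring.
Qed.

Variable z0 : Cn R n.
Hypothesis Uz0 : U z0.

Definition trH z : R[i] := (nsq z)%:C * mtr z.

Hypothesis max_z0 : forall z, U z -> complex.Re (trH z) <= complex.Re (trH z0).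
Hypothesis ge2_z0 : 2 <= complex.Re (trH z0).

Lemma csmooth_trH : csmooth U trH.
Proof. exact: (csmoothM oU (csmooth_nsq oU) csmooth_mtr). Qed.

Lemma mtr_real z : U z -> mtr z = (complex.Re (mtr z))%:C.
Proof.
move=> Uz; rewrite RRe_real //; apply/CrealP; exact: mtrJ.
Qed.

Lemma trH_real z : U z -> trH z = (nsq z * complex.Re (mtr z))%:C.
Proof. by move=> Uz; rewrite rmorphM /= -mtr_real. Qed.

Lemma line_trH v : 'D_v (fun w => complex.Re (trH w)) z0 = 0 /\
  'D_v ('D_v (fun w => complex.Re (trH w))) z0 <= 0.
Proof.
have [s1 _] := csmooth_trH.
have [|E1 E2] := @line_max R _ _ oU _ z0 v 0 0 s1 Uz0.
  apply: filterS (near_line oU v Uz0) => s Us _.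
  by rewrite !mul0r !addr0 ln1 addr0; exact: max_z0.
by move: E1 E2; rewrite addr0 mulr0 addr0 expr2 mulr0 subr0; split.
Qed.

Lemma derive_C_trH v : derive_C v trH z0 = 0.
Proof.
have [E1 _] := line_trH v; rewrite /derive_C E1.
suff -> : 'D_v (fun w => complex.Im (trH w)) z0 = 0 by [].
rewrite -[RHS](derive_cst (0 : R) z0 v).
have H : {in U, (fun w => complex.Im (trH w)) =1 cst (0 : R)}.
  by move=> w; rewrite inE => Uw; rewrite trH_real.
by apply: (derive_eq_on oU v H); rewrite inE; exact: Uz0.
Qed.

Lemma d_z_trH i : d_z i trH z0 = 0.
Proof. by rewrite /d_z /dx /dy !derive_C_trH mulr0 subr0 mulr0. Qed.

Lemma d_zbar_trH i : d_zbar i trH z0 = 0.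
Proof. by rewrite /d_zbar /dx /dy !derive_C_trH mulr0 addr0 mulr0. Qed.

(** At a maximum the complex Hessian is nonpositive, being a Laplacian along a
    real plane. *)
Lemma hessian_trH (e : 'I_n -> R[i]) :
  complex.Re (\sum_i \sum_j e i * (e j)^*%R * d_z i (d_zbar j trH) z0) <= 0.
Proof.
have P := derive_C2_plane oU e csmooth_trH Uz0.
have [_ H1] := line_trH (cvec e).
have [_ H2] := line_trH (cvec (fun i => 'i * e i)).
have := congr1 (@complex.Re R) P; rewrite ReD ReM.
set h := \sum_i _; have -> : complex.Re (4 : R[i]) = 4 by rewrite !ReD /=; ring.
have -> : complex.Im (4 : R[i]) = 0 by rewrite !ImD /=; ring.
rewrite mul0r subr0 => E.
have : 4 * complex.Re h <= 0 by rewrite -E; have := lerD H1 H2; rewrite addr0.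
by rewrite pmulr_rle0.
Qed.

Let q := insq z0.
Let x i := (zcoord z0 i)^*%R * q.
Let uu := mtr z0.

Let xJ i : (x i)^*%R = zcoord z0 i * q.
Proof. by rewrite rmorphM /= conjCK insqJ. Qed.

(** The stationarity of [trH = nsq * mtr] expresses the gradient of [mtr]
    through that of [nsq]. *)
Lemma d_z_mtr_max i : d_z i mtr z0 = - x i * uu.
Proof.
have := d_z_trH i; rewrite (d_zM oU i (csmooth_nsq oU) csmooth_mtr Uz0).
rewrite (d_z_nsq oU i Uz0) => /(congr1 (fun a => q * a)).
rewrite mulr0 mulrDr [q * ((nsq z0)%:C * _)]mulrA (insqK Uz0) mul1r => /eqP.
by rewrite addrC addr_eq0 => /eqP ->; rewrite /x /uu; ring.
Qed.

Lemma d_zbar_mtr_max j : d_zbar j mtr z0 = - (x j)^*%R * uu.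
Proof.
have := d_zbar_trH j; rewrite (d_zbarM oU j (csmooth_nsq oU) csmooth_mtr Uz0).
rewrite (d_zbar_nsq oU j Uz0) => /(congr1 (fun a => q * a)).
rewrite mulr0 mulrDr [q * ((nsq z0)%:C * _)]mulrA (insqK Uz0) mul1r => /eqP.
by rewrite addrC addr_eq0 => /eqP ->; rewrite xJ /uu; ring.
Qed.

Lemma hessian_mtr i j : d_z i (d_zbar j mtr) z0 =
  q * d_z i (d_zbar j trH) z0 - q * uu * (i == j)%:R + 2 * uu * (x i * (x j)^*%R).
Proof.
have sn := csmooth_nsq oU.
have sb := csmooth_d_zbar oU j csmooth_mtr.
have sj := csmooth_zcoord oU j.
have -> : d_z i (d_zbar j trH) z0 =
    d_z i (fun w => zcoord w j * mtr w + (nsq w)%:C * d_zbar j mtr w) z0.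
  apply: (d_z_eq_on oU i Uz0) => w; rewrite inE => Uw.
  by rewrite (d_zbarM oU j sn csmooth_mtr Uw) (d_zbar_nsq oU j Uw).
rewrite (d_zD i (csmoothM oU sj csmooth_mtr) (csmoothM oU sn sb) Uz0).
rewrite (d_zM oU i sj csmooth_mtr Uz0) (d_zM oU i sn sb Uz0) d_z_zcoord.
rewrite (d_z_nsq oU i Uz0) d_z_mtr_max d_zbar_mtr_max -/uu [j == i]eq_sym.
have qN : q * (nsq z0)%:C = 1 := insqK Uz0.
rewrite !mulrDr [q * ((nsq z0)%:C * _)]mulrA qN mul1r xJ /x.
move: (d_z i _ z0) (zcoord z0 i)^*%R (zcoord z0 j) q uu (i == j)%:R.
by move=> a p r s t d; ring.
Qed.

Lemma hermitian_sum_rank1 (e y : 'I_n -> R[i]) :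
  \sum_i \sum_j e i * (e j)^*%R * (y i * (y j)^*%R) =
  (\sum_i e i * y i) * (\sum_i e i * y i)^*%R.
Proof.
rewrite mulr_suml; apply: eq_bigr => i _; rewrite rmorph_sum mulr_sumr.
by apply: eq_bigr => j _; rewrite rmorphM /=; ring.
Qed.

Lemma hermitian_sum_split (e y : 'I_n -> R[i]) (h : 'I_n -> 'I_n -> R[i]) (p a c : R[i]) :
  \sum_i \sum_j e i * (e j)^*%R *
    (p * h i j + a * (i == j)%:R + c * (y i * (y j)^*%R)) =
  p * (\sum_i \sum_j e i * (e j)^*%R * h i j) + a * (\sum_i e i * (e i)^*%R) +
  c * ((\sum_i e i * y i) * (\sum_i e i * y i)^*%R).
Proof.
rewrite -hermitian_sum_rank1 !mulr_sumr -!big_split /=; apply: eq_bigr => i _.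
rewrite -(sum_delta (fun j => a * (e i * (e j)^*%R)) i).
rewrite !mulr_sumr -!big_split /=; apply: eq_bigr => j _.
by rewrite [j == i]eq_sym; ring.
Qed.

(** The contribution of a frame vector [e] to the sum over [k] of the complex
    Laplacians of the barriers; see [d_z_zbar_barrier]. *)
Definition barrier_term (e : 'I_n -> R[i]) : R[i] :=
  let c := \sum_i e i * x i in
  \sum_i \sum_j e i * (e j)^*%R * (\sum_k d_z k (d_zbar k (fun w => g w i j)) z0) +
  c * (\sum_j (e j)^*%R * (\sum_k d_zbar k (fun w => g w k j) z0)) +
  c^*%R * (\sum_i e i * (\sum_k d_z k (fun w => g w i k) z0)) +
  c * c^*%R * (\sum_k g z0 k k).

(** The identity behind the estimate. After exchange of indices and
    stationarity, the dimension [n] disappears, and the terms that are not the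
    Hessian of [trH] combine into a single product of two factors. *)
Lemma barrier_termE (e : 'I_n -> R[i]) :
  let c := \sum_i e i * x i in
  barrier_term e =
  q * (\sum_i \sum_j e i * (e j)^*%R * d_z i (d_zbar j trH) z0) +
  (uu - 2 * q) * (c * c^*%R - q * \sum_i e i * (e i)^*%R).
Proof.
move=> c; rewrite /barrier_term -/c -/(mtr z0) -/uu.
set H := \sum_i \sum_j _ * d_z i (d_zbar j trH) z0.
have -> : \sum_i \sum_j e i * (e j)^*%R *
      (\sum_k d_z k (d_zbar k (fun w => g w i j)) z0) =
    q * H + (2 * q ^+ 2 - q * uu) * (\sum_i e i * (e i)^*%R) +
    (2 * uu - 2 * n%:R * q) * (c * c^*%R).
  rewrite /H /c -hermitian_sum_split; apply: eq_bigr => i _; apply: eq_bigr => j _.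
  rewrite (contracted_curvature i j Uz0) hessian_mtr -/q xJ /x; congr (_ * _).
  move: (d_z i _ z0) (zcoord z0 i)^*%R (zcoord z0 j) q uu.
  by move: (i == j)%:R (n%:R : R[i]) => d m a p r s s'; ring.
have -> : \sum_j (e j)^*%R * (\sum_k d_zbar k (fun w => g w k j) z0) =
    c^*%R * (- uu + (n%:R - 1) * q).
  have -> : c^*%R = \sum_j (e j)^*%R * (x j)^*%R.
    by rewrite rmorph_sum; apply: eq_bigr => j _; rewrite rmorphM.
  rewrite mulr_suml; apply: eq_bigr => j _.
  rewrite (contracted_torsionJ j Uz0) d_zbar_mtr_max !xJ -/q.
  move: (zcoord z0 j) (e j)^*%R q uu (n%:R : R[i]) => a p r s t; ring.
have -> : \sum_i e i * (\sum_k d_z k (fun w => g w i k) z0) =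
    c * (- uu + (n%:R - 1) * q).
  rewrite mulr_suml; apply: eq_bigr => j _.
  rewrite (contracted_torsion j Uz0) d_z_mtr_max /x -/q.
  move: (zcoord z0 j)^*%R (e j) q uu (n%:R : R[i]) => a p r s t; ring.
move: (c^*%R) => c'; move: H uu q c (\sum_i e i * (e i)^*%R) (n%:R : R[i]).
by move=> a1 a2 a3 a4 a5 a6; ring.
Qed.

(** The second factor is a Cauchy-Schwarz defect, because the squared length
    of [x] is the inverse of [nsq z0]; the first one is [(trH - 2) / nsq]. *)
Lemma barrier_term_le0 (e : 'I_n -> R[i]) : complex.Re (barrier_term e) <= 0.
Proof.
have Np := nsq_gt0 Uz0.
rewrite barrier_termE mulJ.
have -> : \sum_i e i * (e i)^*%R = (\sum_i sqn (e i))%:C.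
  by rewrite rmorph_sum; apply: eq_bigr => i _; rewrite mulJ.
have -> : uu = (complex.Re uu)%:C by exact: mtr_real.
rewrite /q /insq -!rmorphM -rmorphB /=.
set H := \sum_i \sum_j _; set r := (nsq z0)^-1.
have -> : (complex.Re uu)%:C - 2 * r%:C = (complex.Re uu - 2 * r)%:C.
  by rewrite rmorphB rmorphM rmorph_nat.
rewrite ReD -rmorphM ReM /= mul0r subr0.
have r0 : 0 < r by rewrite invr_gt0.
have Hle : r * complex.Re H <= 0.
  by rewrite pmulr_rle0 //; exact: hessian_trH.
have u2 : 0 <= complex.Re uu - 2 * r.
  rewrite subr_ge0 /r ler_pdivrMr // mulrC.
  by have := ge2_z0; rewrite trH_real.
have CS := csum_CS e x.
have sx : \sum_i sqn (x i) = r.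
  have -> : \sum_i sqn (x i) = nsq z0 * r ^+ 2.
    rewrite /nsq mulr_suml; apply: eq_bigr => i _; rewrite /x sqnM sqnJ; congr (_ * _).
    by rewrite /sqn /= expr0n addr0.
  by rewrite expr2 mulrA divff ?mul1r // gt_eqF.
rewrite sx mulrC in CS.
rewrite -subr_le0 in CS.
by have := lerD Hle (mulr_ge0_le0 u2 CS); rewrite addr0.
Qed.

End MaximumPoint.

(** * The barrier for the determinant *)

Section Arith.
Context {R : realType}.

Lemma barrier_arith (p r s t y m : R) :
  p + (s + t) <= y - m -> r + s = 0 -> p + t - y <= r - m.
Proof. by move=> h1 h2; lra. Qed.

(** The logarithm of [|1 + zeta x_k|^2] is pluriharmonic: its second
    derivatives along the two real directions of the [zeta] line add up to
    zero, so they leave no trace in the sum. *)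
Lemma plane_arith (p r : R) (y : R[i]) :
  p + 2 * sqn (1 * y) - (2 * complex.Re (1 * y)) ^+ 2 <= 0 ->
  r + 2 * sqn ('i * y) - (2 * complex.Re ('i * y)) ^+ 2 <= 0 -> p + r <= 0.
Proof. by case: y => c d; rewrite /sqn /= => h1 h2; nra. Qed.

Lemma Re_realM (c : R) (y : R[i]) : complex.Re (c%:C * y) = c * complex.Re y.
Proof. by case: y => p r; rewrite /= mul0r subr0. Qed.

End Arith.

Section Barrier.
Context {R : realType} {n : nat}.
Implicit Types (z v w : Cn R n) (i j k a b : 'I_n).
Local Notation U := (@punctured R n).
Local Notation oU := (@open_punctured R n).

Lemma d_z_zbar_diag (V : set (Cn R n)) (oV : open V) k (f : Cn R n -> R[i]) z :
  csmooth V f -> V z ->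
  d_z k (d_zbar k f) z = 4^-1 * (dx k (dx k f) z + dy k (dy k f) z).
Proof.
move=> sf Vz; rewrite d_zE d_zbarE {1}/wirtinger /(dx k) /(dy k).
rewrite !(derive_C_wirtinger oV _ _ _ sf Vz) /dx /dy.
rewrite (derive_CC oV (0, delta_mx 0 k) (delta_mx 0 k, 0) sf Vz).
have alg (p r s : R[i]) : 2^-1 * (2^-1 * (p + 'i * r) + - 'i * (2^-1 * (r + 'i * s))) =
    4^-1 * (p + s).
  have -> : 2^-1 * (2^-1 * (p + 'i * r) + - 'i * (2^-1 * (r + 'i * s))) =
    2^-1 * 2^-1 * (p - 'i * 'i * s) by ring.
  by rewrite mul_ii mulN1r opprK -invfM -natrM.
exact: alg.
Qed.

Lemma rank1_update (e : 'I_n -> R[i]) (t : R[i]) (h : 'I_n -> 'I_n -> R[i]) k :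
  \sum_i \sum_j (e i + t * (i == k)%:R) * (e j + t * (j == k)%:R)^*%R * h i j =
  (\sum_i \sum_j e i * (e j)^*%R * h i j) + t * (\sum_j (e j)^*%R * h k j) +
  t^*%R * (\sum_i e i * h i k) + t * t^*%R * h k k.
Proof.
have J j : (e j + t * (j == k)%:R)^*%R = (e j)^*%R + (j == k)%:R * t^*%R.
  by rewrite rmorphD rmorphM rmorph_nat /= [_ * t^*%R]mulrC.
have I i : \sum_j (e i + t * (i == k)%:R) * (e j + t * (j == k)%:R)^*%R * h i j =
    (e i + t * (i == k)%:R) * (\sum_j (e j)^*%R * h i j + t^*%R * h i k).
  rewrite -(sum_delta (fun j => t^*%R * h i j) k) -big_split mulr_sumr.
  by apply: eq_bigr => j _ /=; rewrite J; ring.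
rewrite (eq_bigr _ (fun i _ => I i)).
pose r i := \sum_j (e j)^*%R * h i j + t^*%R * h i k.
have -> : \sum_i (e i + t * (i == k)%:R) * r i = \sum_i e i * r i + t * r k.
  rewrite -(sum_delta r k) mulr_sumr -big_split; apply: eq_bigr => i _ /=.
  by rewrite mulrDl mulrA.
have -> : \sum_i e i * r i = (\sum_i \sum_j e i * (e j)^*%R * h i j) +
    t^*%R * (\sum_i e i * h i k).
  rewrite mulr_sumr -big_split; apply: eq_bigr => i _ /=; rewrite mulrDr mulr_sumr.
  congr (_ + _); last by rewrite mulrCA.
  by apply: eq_bigr => j _; rewrite mulrA.
by rewrite /r; ring.
Qed.

Variable g : Cn R n -> 'M[R[i]]_n.
Hypothesis sg : forall i j, csmooth U (fun w => g w i j).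
Hypothesis pg : forall z, U z -> posdefmx (g z).

Definition log_det w : R := ln (complex.Re (\det (g w))).

Lemma smooth_log_det : smooth_open U log_det.
Proof.
apply: smooth_ln; first exact: oU.
  by move=> z /pg/posdef_det[d d0 ->].
by have [h _] := csmooth_det oU sg; exact: h.
Qed.

Variable z0 : Cn R n.
Hypothesis Uz0 : U z0.
Variable E : 'M[R[i]]_n.
Hypothesis uE : E \in unitmx.
Hypothesis EE : E *m g z0 *m ctr E = 1%:M.

(** The vector [x] of the shear: the gradient of [log nsq] at the maximum
    point. *)
Definition radial i : R[i] := (zcoord z0 i)^*%R * insq z0.
Definition frame_radial a : R[i] := \sum_i E a i * radial i.

Variable k : 'I_n.

Definition zeta w : R[i] := zcoord w k - zcoord z0 k.

(** The trace of [P g P^*], expanded, where [P] is the frame [E] sheared by [1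
    + zeta x e_k^T]. *)
Definition barrier w : R[i] := \sum_a
  ((\sum_i \sum_j E a i * (E a j)^*%R * g w i j) +
   zeta w * (frame_radial a * (\sum_j (E a j)^*%R * g w k j)) +
   (zeta w)^*%R * ((frame_radial a)^*%R * (\sum_i E a i * g w i k)) +
   zeta w * ((zeta w)^*%R * (frame_radial a * (frame_radial a)^*%R * g w k k))).

Let szeta : csmooth U zeta.
Proof. exact: (csmoothB oU (csmooth_zcoord oU k) (csmooth_cst oU _)). Qed.

Let zeta0 : zeta z0 = 0.
Proof. exact: subrr. Qed.

Let d_z_zeta w : U w -> d_z k zeta w = 1.
Proof.
move=> Uw; rewrite (d_zD k (csmooth_zcoord oU k) (csmooth_cst oU _) Uw).
by rewrite d_z_cst d_z_zcoord eqxx addr0.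
Qed.

Let d_zbar_zeta w : U w -> d_zbar k zeta w = 0.
Proof.
move=> Uw; rewrite (d_zbarD k (csmooth_zcoord oU k) (csmooth_cst oU _) Uw).
by rewrite d_zbar_cst d_zbar_zcoord addr0.
Qed.

Let d_z_zetaJ w : U w -> d_z k (fun y => (zeta y)^*%R) w = 0.
Proof. by move=> Uw; rewrite (d_zJ k szeta Uw) d_zbar_zeta // rmorph0. Qed.

Let d_zbar_zetaJ w : U w -> d_zbar k (fun y => (zeta y)^*%R) w = 1.
Proof. by move=> Uw; rewrite (d_zbarJ k szeta Uw) d_z_zeta // rmorph1. Qed.

Let szetaJ : csmooth U (fun w => (zeta w)^*%R).
Proof. exact: (csmoothJ oU szeta). Qed.

Let dd f := d_z k (d_zbar k f) z0.

Let ddD f h : csmooth U f -> csmooth U h -> dd (fun w => f w + h w) = dd f + dd h.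
Proof.
move=> sf sh; rewrite /dd.
rewrite -(d_zD k (csmooth_d_zbar oU k sf) (csmooth_d_zbar oU k sh) Uz0).
by apply: (d_z_eq_on oU k Uz0) => w; rewrite inE => Uw; rewrite (d_zbarD k sf sh Uw).
Qed.

Let ddZ c f : csmooth U f -> dd (fun w => c * f w) = c * dd f.
Proof.
move=> sf; rewrite /dd -(d_zZ oU k c (csmooth_d_zbar oU k sf) Uz0).
by apply: (d_z_eq_on oU k Uz0) => w; rewrite inE => Uw; exact: (d_zbarZ oU).
Qed.

Let dd_sum (I : Type) (r : seq I) (F : I -> Cn R n -> R[i]) :
  (forall l, csmooth U (F l)) -> dd (fun w => \sum_(l <- r) F l w) = \sum_(l <- r) dd (F l).
Proof.
move=> sF; rewrite /dd.
rewrite -(d_z_sum oU k r (fun l => csmooth_d_zbar oU k (sF l)) Uz0).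
by apply: (d_z_eq_on oU k Uz0) => w; rewrite inE => Uw; exact: (d_zbar_sum oU).
Qed.

Let dd_zeta f : csmooth U f -> dd (fun w => zeta w * f w) = d_zbar k f z0.
Proof.
move=> sf; have sb := csmooth_d_zbar oU k sf; rewrite /dd.
have -> : d_z k (d_zbar k (fun w => zeta w * f w)) z0 =
    d_z k (fun w => zeta w * d_zbar k f w) z0.
  apply: (d_z_eq_on oU k Uz0) => w; rewrite inE => Uw.
  by rewrite (d_zbarM oU k szeta sf Uw) (d_zbar_zeta Uw) mul0r add0r.
by rewrite (d_zM oU k szeta sb Uz0) (d_z_zeta Uz0) zeta0 mul0r addr0 mul1r.
Qed.

Let dd_zetaJ f : csmooth U f -> dd (fun w => (zeta w)^*%R * f w) = d_z k f z0.
Proof.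
move=> sf; rewrite /dd (d_z_zbarC oU _ _ (csmoothM oU szetaJ sf) Uz0).
have sb := csmooth_d_z oU k sf.
have -> : d_zbar k (d_z k (fun w => (zeta w)^*%R * f w)) z0 =
    d_zbar k (fun w => (zeta w)^*%R * d_z k f w) z0.
  apply: (d_zbar_eq_on oU k Uz0) => w; rewrite inE => Uw.
  by rewrite (d_zM oU k szetaJ sf Uw) (d_z_zetaJ Uw) mul0r add0r.
rewrite (d_zbarM oU k szetaJ sb Uz0) (d_zbar_zetaJ Uz0) zeta0 rmorph0 mul0r addr0.
by rewrite mul1r.
Qed.

Let A a w : R[i] := \sum_i \sum_j E a i * (E a j)^*%R * g w i j.
Let B a w : R[i] := frame_radial a * (\sum_j (E a j)^*%R * g w k j).
Let B' a w : R[i] := (frame_radial a)^*%R * (\sum_i E a i * g w i k).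
Let C a w : R[i] := frame_radial a * (frame_radial a)^*%R * g w k k.

Let sA a : csmooth U (A a).
Proof.
exact: (csmooth_sum oU _ (fun i => csmooth_sum oU _ (fun j => csmoothZ oU _ (sg i j)))).
Qed.
Let sB a : csmooth U (B a).
Proof. exact: (csmoothZ oU _ (csmooth_sum oU _ (fun j => csmoothZ oU _ (sg k j)))). Qed.
Let sB' a : csmooth U (B' a).
Proof. exact: (csmoothZ oU _ (csmooth_sum oU _ (fun i => csmoothZ oU _ (sg i k)))). Qed.
Let sC a : csmooth U (C a).
Proof. exact: (csmoothZ oU _ (sg k k)). Qed.

Let sT a : csmooth U (fun w => A a w + zeta w * B a w + (zeta w)^*%R * B' a w +
  zeta w * ((zeta w)^*%R * C a w)).
Proof.
exact: (csmoothD oU (csmoothD oU (csmoothD oU (sA a) (csmoothM oU szeta (sB a)))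
  (csmoothM oU szetaJ (sB' a))) (csmoothM oU szeta (csmoothM oU szetaJ (sC a)))).
Qed.

Lemma csmooth_barrier : csmooth U barrier.
Proof. exact: (csmooth_sum oU _ sT). Qed.

(** Since [zeta] is holomorphic and vanishes at [z0], each of its powers
    selects one mixed derivative. *)
Lemma d_z_zbar_barrier : d_z k (d_zbar k barrier) z0 = \sum_a
  ((\sum_i \sum_j E a i * (E a j)^*%R * d_z k (d_zbar k (fun w => g w i j)) z0) +
   frame_radial a * (\sum_j (E a j)^*%R * d_zbar k (fun w => g w k j) z0) +
   (frame_radial a)^*%R * (\sum_i E a i * d_z k (fun w => g w i k) z0) +
   frame_radial a * (frame_radial a)^*%R * g z0 k k).
Proof.
rewrite -/(dd barrier) (dd_sum _ sT); apply: eq_bigr => a _.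
have s1 := csmoothM oU szeta (sB a); have s2 := csmoothM oU szetaJ (sB' a).
have s3' := csmoothM oU szetaJ (sC a); have s3 := csmoothM oU szeta s3'.
rewrite (ddD (csmoothD oU (csmoothD oU (sA a) s1) s2) s3).
rewrite (ddD (csmoothD oU (sA a) s1) s2) (ddD (sA a) s1).
rewrite (dd_zeta (sB a)) (dd_zetaJ (sB' a)) (dd_zeta s3').
rewrite (d_zbarM oU k szetaJ (sC a) Uz0) (d_zbar_zetaJ Uz0) zeta0 rmorph0 mul0r addr0.
rewrite mul1r; congr (_ + _ + _ + _).
- rewrite (dd_sum _ (fun i => csmooth_sum oU _ (fun j => csmoothZ oU _ (sg i j)))).
  apply: eq_bigr => i _; rewrite (dd_sum _ (fun j => csmoothZ oU _ (sg i j))).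
  by apply: eq_bigr => j _; rewrite (ddZ _ (sg i j)).
- rewrite (d_zbarZ oU k _ (csmooth_sum oU _ (fun j => csmoothZ oU _ (sg k j))) Uz0).
  rewrite (d_zbar_sum oU k _ (fun j => csmoothZ oU _ (sg k j)) Uz0); congr (_ * _).
  by apply: eq_bigr => j _; rewrite (d_zbarZ oU k _ (sg k j) Uz0).
- rewrite (d_zZ oU k _ (csmooth_sum oU _ (fun i => csmoothZ oU _ (sg i k))) Uz0).
  rewrite (d_z_sum oU k _ (fun i => csmoothZ oU _ (sg i k)) Uz0); congr (_ * _).
  by apply: eq_bigr => i _; rewrite (d_zZ oU k _ (sg i k) Uz0).
Qed.

Let shear w : 'M[R[i]]_n :=
  E *m (1%:M + zeta w *: (\matrix_(i, j) (radial i *+ (j == k)))).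

Let shearE w a j : shear w a j = E a j + zeta w * frame_radial a * (j == k)%:R.
Proof.
rewrite /shear mulmxDr mulmx1 -scalemxAr !mxE; congr (_ + _).
rewrite -mulrA; congr (_ * _); rewrite /frame_radial mulr_suml; apply: eq_bigr => i _.
by rewrite !mxE !mulrnAr mulr1.
Qed.

Let tr_shear w : \tr (shear w *m g w *m ctr (shear w)) = barrier w.
Proof.
apply: eq_bigr => a _.
have := rank1_update (fun i => E a i) (zeta w * frame_radial a) (fun i j => g w i j) k.
set rhs := (X in _ = X) => H.
have -> : (A a w + zeta w * B a w + (zeta w)^*%R * B' a w +
  zeta w * ((zeta w)^*%R * C a w)) = rhs.
  by rewrite /rhs /A /B /B' /C rmorphM /=; ring.
rewrite -H mxE exchange_big; apply: eq_bigr => j _ /=.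
rewrite ctrE shearE mxE mulr_suml; apply: eq_bigr => i _; rewrite shearE.
by rewrite mulrAC.
Qed.

(** The inequality [log det A <= tr A - n] for [A = P g P^*]; it is an
    equality at [z0], where [A] is the identity. *)
Lemma log_det_barrier w : U w -> 0 < sqn (1 + zeta w * radial k) ->
  log_det w + ln (sqn (1 + zeta w * radial k)) - complex.Re (barrier w) <=
  log_det z0 - complex.Re (barrier z0).
Proof.
move=> Uw Nw.
have Z0 : log_det z0 + ln (sqn (\det E)) = 0 by exact: ln_det_congr1 (pg Uz0) uE.
have B0 : complex.Re (barrier z0) = n%:R.
  rewrite -tr_shear /shear zeta0 scale0r addr0 mulmx1 EE mxtrace1.
  by rewrite -[n%:R in LHS](rmorph_nat (real_complex R)).
have uS : shear w \in unitmx.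
  rewrite unitmx_mul uE unitmxE det_add_col unitfE /=.
  by apply/eqP => h; move: Nw; rewrite h /sqn /= expr0n addr0 ltxx.
have := posdef_ln_det_congr uS (pg Uw); rewrite tr_shear -/(log_det w).
rewrite /shear det_mulmx det_add_col sqnM lnM ?posrE //; last first.
  by apply: sqn_gt0; rewrite -unitfE -unitmxE.
by rewrite B0 => H; exact: barrier_arith H Z0.
Qed.

Let zeta_line v (s : R) : zeta (z0 + s *: v) = s%:C * zcoord v k.
Proof.
rewrite /zeta /zcoord /= !mxE.
by apply: complex_ext; rewrite /=; ring.
Qed.

Let Uf w := log_det w - complex.Re (barrier w).

Let sUf : smooth_open U Uf.
Proof.
by have [h _] := csmooth_barrier; exact: (smoothB oU smooth_log_det h).
Qed.

Let line_Uf v : 'D_v ('D_v Uf) z0 + 2 * sqn (zcoord v k * radial k) -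
  (2 * complex.Re (zcoord v k * radial k)) ^+ 2 <= 0.
Proof.
set y := zcoord v k * radial k.
have NE s : sqn (1 + zeta (z0 + s *: v) * radial k) =
    1 + 2 * complex.Re y * s + sqn y * s ^+ 2.
  rewrite zeta_line -mulrA -/y; case: y => p r; rewrite /sqn /=; ring.
have [|_] := @line_max R _ _ oU Uf z0 v (2 * complex.Re y) (sqn y) sUf Uz0; last by [].
apply: filterS (near_line oU v Uz0) => s Us; rewrite -NE => Ns.
by have := log_det_barrier Us Ns; rewrite addrAC.
Qed.

(** By [log_det_barrier], the difference of the two functions, corrected by a
    pluriharmonic term, is maximal at [z0]; the second derivative test applies
    along the two real directions of the [k]-th coordinate. *)
Lemma ddbar_log_det_le :
  complex.Re (ddbar log_det z0 k k) <= complex.Re (d_z k (d_zbar k barrier) z0).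
Proof.
pose f w : R[i] := (log_det w)%:C - barrier w.
have sF := csmooth_real oU smooth_log_det.
have sf : csmooth U f by exact: (csmoothB oU sF csmooth_barrier).
have -> : ddbar log_det z0 k k = dd (fun w => (log_det w)%:C) by rewrite mxE.
have : dd f = dd (fun w => (log_det w)%:C) - dd barrier.
  rewrite -mulN1r -(ddZ (-1) csmooth_barrier).
  rewrite -(ddD sF (csmoothZ oU (-1) csmooth_barrier)).
  apply: (d_z_eq_on oU k Uz0) => w; rewrite inE => Uw.
  by apply: (d_zbar_eq_on oU k Uw) => y _; rewrite mulN1r.
rewrite {1}/dd (d_z_zbar_diag oU k sf Uz0) => /(congr1 (@complex.Re R)).
have ReB (p r : R[i]) : complex.Re (p - r) = complex.Re p - complex.Re r.
  by case: p; case: r.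
rewrite ReB -subr_le0 => <-.
have -> : 4^-1 = (4^-1 : R)%:C :> R[i] by rewrite fmorphV rmorph_nat.
rewrite Re_realM ReD pmulr_rle0 ?invr_gt0 // /dx /dy /derive_C /=.
have fE : (fun w => complex.Re (f w)) = Uf.
  by apply/funext => w; rewrite /f ReB.
rewrite fE.
have e1 : zcoord ((delta_mx 0 k, 0) : Cn R n) k = 1.
  by rewrite /zcoord /= !mxE !eqxx.
have e2 : zcoord ((0, delta_mx 0 k) : Cn R n) k = 'i.
  by rewrite /zcoord /= !mxE !eqxx.
have H1 := line_Uf (delta_mx 0 k, 0); have H2 := line_Uf (0, delta_mx 0 k).
rewrite e1 in H1; rewrite e2 in H2.
exact: plane_arith H1 H2.
Qed.

End Barrier.

Section RicciTrace.
Context {R : realType} {n : nat}.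
Implicit Types (z v w : Cn R n) (i j k a b : 'I_n).
Local Notation U := (@punctured R n).
Local Notation oU := (@open_punctured R n).
Variable g : Cn R n -> 'M[R[i]]_n.
Hypothesis sg : forall i j, csmooth U (fun w => g w i j).
Hypothesis pg : forall z, U z -> posdefmx (g z).
Hypothesis torg : forall z, U z -> forall i k b,
  d_z k (fun w => g w i b) z - d_z i (fun w => g w k b) z = torsion_H z i k b.

(** Each diagonal coefficient of [ddbar] of the log-determinant is bounded by
    that of its barrier; summed over [k], the barriers give one [barrier_term]
    for each vector of the frame, and these are nonpositive. *)
Lemma ricci_trace_le0 z0 : U z0 ->
  (forall z, U z -> complex.Re (trH g z) <= complex.Re (trH g z0)) ->
  2 <= complex.Re (trH g z0) ->
  \sum_k complex.Re (ddbar (log_det g) z0 k k) <= 0.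
Proof.
move=> Uz0 mz0 gez0; have [E [uE EE]] := posdef_factor (pg Uz0).
apply: (@le_trans _ _ (\sum_k complex.Re (d_z k (d_zbar k (barrier g z0 E k)) z0))).
  by apply: ler_sum => k _; exact: ddbar_log_det_le.
rewrite -Re_sum (eq_bigr _ (fun k _ => d_z_zbar_barrier sg Uz0 E k)) exchange_big /=.
rewrite Re_sum; apply: sumr_le0 => a _.
apply: le_trans (barrier_term_le0 sg pg torg Uz0 mz0 gez0 (fun i => E a i)).
rewrite le_eqVlt; apply/orP; left; apply/eqP; congr complex.Re.
rewrite /barrier_term -/(frame_radial z0 E a) !big_split /=; congr (_ + _ + _ + _).
- rewrite exchange_big; apply: eq_bigr => i _ /=; rewrite exchange_big.
  by apply: eq_bigr => j _ /=; rewrite mulr_sumr.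
- rewrite -mulr_sumr exchange_big; congr (_ * _); apply: eq_bigr => j _ /=.
  by rewrite mulr_sumr.
- rewrite -mulr_sumr exchange_big; congr (_ * _); apply: eq_bigr => j _ /=.
  by rewrite mulr_sumr.
- by rewrite -mulr_sumr.
Qed.

End RicciTrace.

(** * Time evolution of spatial derivatives *)

Section Evolution.
Context {R : realType}.
Variable T : R.
Hypothesis T0 : 0 < T.

(** A function of time which is continuous up to the initial time and has the
    given derivative at later times. Both parts are stable under the linear
    combinations that define [d_z]. *)
Definition evolves (phi psi : R -> R) : Prop :=
  (forall t, 0 < t < T -> is_derive t 1 phi (psi t)) /\ phi @ 0^'+ --> phi 0.

Lemma evolvesD p1 q1 p2 q2 : evolves p1 q1 -> evolves p2 q2 ->
  evolves (fun t => p1 t + p2 t) (fun t => q1 t + q2 t).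
Proof.
move=> [d1 c1] [d2 c2]; split; last exact: (cvgD c1 c2).
by move=> t tT; exact: (is_deriveD (d1 t tT) (d2 t tT)).
Qed.

Lemma evolvesZ c p q : evolves p q -> evolves (fun t => c * p t) (fun t => c * q t).
Proof.
move=> [d1 c1]; split; last exact: (cvgM (cvg_cst c) c1).
by move=> t tT; exact: (is_deriveZ c (d1 t tT)).
Qed.

Lemma evolves0_cst p q : evolves p q -> (forall t, 0 < t < T -> q t = 0) ->
  forall t, 0 <= t < T -> p t = p 0.
Proof.
move=> [dp cp] q0 t /andP[t0 tT].
have [->//|tn0] := eqVneq t 0.
have {}t0 : 0 < t by rewrite lt_neqAle eq_sym tn0.
have [||c _] := @MVT R p (fun=> 0) 0 t t0.
- move=> s; rewrite in_itv /= => /andP[s0 st].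
  have sT : 0 < s < T by rewrite s0 (lt_trans st).
  by rewrite -(q0 s sT); exact: dp.
- apply/continuous_within_itvP => //; split => //.
    move=> s; rewrite in_itv /= => /andP[s0 st].
    have sT : 0 < s < T by rewrite s0 (lt_trans st).
    exact: (is_derive_continuous (dp s sT)).
  have tT' : 0 < t < T by rewrite t0.
  by apply: cvg_at_left_filter; exact: (is_derive_continuous (dp t tT')).
by rewrite mul0r => /eqP; rewrite subr_eq0 => /eqP.
Qed.

End Evolution.

Section SpaceTime.
Context {R : realType} {V : normedModType R}.
Implicit Types (f : R * V -> R) (v z : V).

(** Smoothness is a pointwise requirement. *)
Lemma smooth_openW (W : normedModType R) (A B : set W) (h : W -> R) :
  B `<=` A -> smooth_open A h -> smooth_open B h.
Proof. by move=> BA sh vs x /BA; exact: sh. Qed.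

Variables (U : set V) (T : R).
Hypotheses (oU : open U) (T0 : 0 < T).
Let A : set (R * V) := [set p | 0 <= p.1 < T /\ U p.2].

(** At an interior time the restriction to the time interval is immaterial. *)
Lemma is_derive_of_within (h : R -> R) (t l : R) : 0 < t < T ->
  has_derive_within [set s | 0 <= s < T] h t l -> is_derive t 1 h l.
Proof.
move=> /andP[t0 tT] H.
have Q : (fun k => k^-1 *: ((h \o shift t) (k *: 1) - h t)) @ 0^' --> l.
  have -> : (fun k => k^-1 *: ((h \o shift t) (k *: 1) - h t)) =
      (fun k => k^-1 * (h (t + k) - h t)).
    by apply/funext => k /=; rewrite [_%:A]mulr1 [k + t]addrC.
  move/cvgrPdist_lt: H => H; apply/cvgrPdist_lt => e e0.
  have := H e e0; rewrite near_withinE => He.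
  have N : \forall k \near (0 : R)^', 0 <= t + k < T.
    apply/nbhs_ballP; exists (Num.min t (T - t)).
      by rewrite /= lt_min t0 subr_gt0.
    move=> k; rewrite -ball_normE /= sub0r normrN lt_min => /andP[k1 k2] _.
    move: k1 k2; rewrite !ltr_norml => /andP[k1 _] /andP[_ k2].
    by apply/andP; split; lra.
  by apply: filterS2 He N => k Hk /Hk.
by split; [apply/cvg_ex; exists l | exact: cvg_lim].
Qed.

Lemma open_spacetime (W : set (R * V)) : open W ->
  open (W `&` [set p | 0 < p.1 < T /\ U p.2]).
Proof.
move=> oW; apply: openI => //.
have -> : [set p : R * V | 0 < p.1 < T /\ U p.2] =
    (fst @^-1` `]0, T[%classic) `&` (snd @^-1` U).
  by rewrite eqEsubset; split => p /=; rewrite in_itv.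
apply: openI; apply: open_comp => //; try exact: interval_open.
  by move=> p _; exact: cvg_fst.
by move=> p _; exact: cvg_snd.
Qed.

(** At positive times, this is Schwarz's theorem in space-time. At the initial
    time the smooth extension past the boundary of the domain provides
    continuity. *)
Lemma evolves_space_derivative f (r : R -> V -> R) v z : smooth_on A f -> U z ->
  (forall t w, 0 <= t < T -> U w ->
     has_derive_within [set s | 0 <= s < T] (fun s => f (s, w)) t (r t w)) ->
  evolves T (fun t => 'D_v (fun w => f (t, w)) z) (fun t => 'D_v (r t) z).
Proof.
move=> sf Uz df; split.
  move=> t tT; have tI : 0 <= t < T by case/andP: tT => /ltW -> ->.
  have [W [F [oW Wp sF FE]]] := sf (t, z) (conj tI Uz).
  (* Near an interior time the domain is a neighbourhood, hence f is smooth. *)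
  set O := W `&` [set p | 0 < p.1 < T /\ U p.2].
  have oO : open O := open_spacetime oW.
  have Op : O (t, z) by [].
  have sfO : smooth_open O f.
    apply: (smooth_eq_on oO _ (smooth_openW _ sF)); last by move=> p [].
    move=> p; rewrite inE => -[Wp' [/andP[p0 pT] Up]]; apply: FE => //.
    by split => //; rewrite ltW.
  have st := smooth_derive (0, v) sfO.
  have dE : {in O, 'D_(1, 0) f =1 (fun p => r p.1 p.2)}.
    move=> [s w]; rewrite inE => -[_ /= [sT Uw]]; rewrite derive_time_slice.
    have sI : 0 <= s < T by case/andP: sT => /ltW -> ->.
    by have [_ ->] := is_derive_of_within sT (df s w sI Uw).
  have D1 : is_derive (t, z) (1, 0) ('D_(0, v) f) ('D_v (r t) z).
    apply: (@DeriveDef _ _ _ _ _ _ _ (smooth_derivable st Op)).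
    rewrite (smooth_deriveC oO _ _ sfO Op).
    have zO : (t, z) \in O by rewrite inE.
    by rewrite (derive_eq_on oO _ dE zO) derive_space_slice.
  have := is_derive_time_slice D1.
  suff -> : (fun s => 'D_(0, v) f (s, z)) = (fun s => 'D_v (fun w => f (s, w)) z) by [].
  by apply/funext => s; rewrite derive_space_slice.
(* At time 0, the slices of the smooth extension F agree with those of f. *)
have tI : 0 <= (0 : R) < T by rewrite lexx.
have [W [F [oW Wp sF FE]]] := sf (0, z) (conj tI Uz).
have cF := smooth_continuous (smooth_derive (0, v) sF) Wp.
have slice s : W (s, z) -> 0 <= s < T ->
    'D_(0, v) F (s, z) = 'D_v (fun w => f (s, w)) z.
  move=> Ws sI; rewrite derive_space_slice; apply: near_eq_derive.
  have N1 : \forall w \near z, W (s, w).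
    have [[P Q] /= [P1 Q1] PQ] := open_nbhs_nbhs (conj oW Ws).
    apply: filterS Q1 => w Qw; apply: PQ; split => //=.
    exact: nbhs_singleton.
  apply: filterS2 N1 (open_nbhs_nbhs (conj oU Uz)) => w Ww Uw.
  exact: (FE (s, w)).
have H : 'D_(0, v) F (s, z) @[s --> (0 : R)] --> 'D_(0, v) F (0, z).
  have c0 : {for 0, continuous (fun s : R => (s, z))}.
    exact: (@cvg_pair R R V (nbhs (0 : R)) (nbhs (0 : R)) (nbhs z) _ _ _ id (fun=> z)
      cvg_id (cvg_cst z)).
  exact: (continuous_comp c0 cF).
have NW : \forall s \near (0 : R), W (s, z).
  have [[P Q] /= [P1 Q1] PQ] := open_nbhs_nbhs (conj oW Wp).
  apply: filterS P1 => s Ps; apply: PQ; split => //=.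
  exact: nbhs_singleton.
rewrite -(slice 0 Wp tI).
have H' := cvg_at_right_filter H.
apply: cvg_trans H'; apply: near_eq_cvg.
near=> s; apply: slice.
  by near: s; exact: cvg_at_right_filter NW.
by apply/andP; split; [apply: ltW|]; near: s; [exact: nbhs_right_gt|exact: nbhs_right_lt].
Unshelve. all: by end_near. Qed.

End SpaceTime.

Section ComplexEvolution.
Context {R : realType}.
Variable T : R.

Definition evolvesC (phi psi : R -> R[i]) : Prop :=
  evolves T (fun t => complex.Re (phi t)) (fun t => complex.Re (psi t)) /\
  evolves T (fun t => complex.Im (phi t)) (fun t => complex.Im (psi t)).

Lemma evolves_eq (p q p' q' : R -> R) : p =1 p' -> q =1 q' ->
  evolves T p q -> evolves T p' q'.
Proof. by move=> /funext -> /funext ->. Qed.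

Lemma evolvesC_D p1 q1 p2 q2 : evolvesC p1 q1 -> evolvesC p2 q2 ->
  evolvesC (fun t => p1 t + p2 t) (fun t => q1 t + q2 t).
Proof.
move=> [a1 b1] [a2 b2]; split.
  by apply: (evolves_eq _ _ (evolvesD a1 a2)) => t; rewrite ReD.
by apply: (evolves_eq _ _ (evolvesD b1 b2)) => t; rewrite ImD.
Qed.

Lemma evolvesC_Z c p q : evolvesC p q ->
  evolvesC (fun t => c * p t) (fun t => c * q t).
Proof.
move=> [a b]; split.
  apply: (evolves_eq _ _ (evolvesD (evolvesZ (complex.Re c) a)
    (evolvesZ (- complex.Im c) b))) => t;
    by rewrite ReM mulNr.
by apply: (evolves_eq _ _ (evolvesD (evolvesZ (complex.Re c) b)
  (evolvesZ (complex.Im c) a))) => t; rewrite ImM.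
Qed.

Lemma evolvesC0_cst p q : evolvesC p q -> (forall t, 0 < t < T -> q t = 0) ->
  forall t, 0 <= t < T -> p t = p 0.
Proof.
move=> [a b] q0 t tT; apply: complex_ext.
  by apply: (evolves0_cst a) => // s sT; rewrite q0.
by apply: (evolves0_cst b) => // s sT; rewrite q0.
Qed.

End ComplexEvolution.

(** * Preservation of the torsion *)

Section FlowTorsion.
Context {R : realType} {n : nat}.
Implicit Types (z v w : Cn R n) (i j k b : 'I_n).
Local Notation U := (@punctured R n).
Local Notation oU := (@open_punctured R n).
Variables (alpha : Cn R n) (T : R) (psi : Cn R n -> R).
Variables (omega0 : Cn R n -> 'M[R[i]]_n) (omega : R -> Cn R n -> 'M[R[i]]_n).
Hypothesis T0 : 0 < T.
Hypothesis spsi : smooth_open U psi.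
Hypothesis omega0E : forall z, U z -> omega0 z = omega_H z + ddbar psi z.
Hypothesis flow : chern_ricci_flow alpha T omega0 omega.

Lemma flow_csmooth t i j : 0 <= t < T -> csmooth U (fun w => omega t w i j).
Proof.
move=> tT; have [_ hm _ _] := flow; have [s1 s2 _ _] := hm t tT.
by split; [exact: s1 | exact: s2].
Qed.

Lemma flow_posdef t z : 0 <= t < T -> U z -> posdefmx (omega t z).
Proof.
move=> tT Uz; have [_ hm _ _] := flow; have [_ _ pz _] := hm t tT.
exact: pz.
Qed.

Lemma opp_chern_ricci t w i j :
  - chern_ricci (omega t) w i j = ddbar (log_det (omega t)) w i j.
Proof. by rewrite /chern_ricci !mxE opprK. Qed.

Lemma evolves_derive_C v i j z : U z ->
  evolvesC T (fun t => derive_C v (fun w => omega t w i j) z)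
    (fun t => derive_C v (fun w => ddbar (log_det (omega t)) w i j) z).
Proof.
move=> Uz; have [sm _ dm _] := flow; have [s1 s2] := sm i j; split.
  apply: (evolves_space_derivative oU T0 v s1 Uz (r := fun t w =>
    complex.Re (ddbar (log_det (omega t)) w i j))) => t w tT Uw.
  by have [h _] := dm t w i j tT Uw; rewrite opp_chern_ricci in h; exact: h.
apply: (evolves_space_derivative oU T0 v s2 Uz (r := fun t w =>
  complex.Im (ddbar (log_det (omega t)) w i j))) => t w tT Uw.
by have [_ h] := dm t w i j tT Uw; rewrite opp_chern_ricci in h; exact: h.
Qed.

Lemma evolves_d_z k i j z : U z ->
  evolvesC T (fun t => d_z k (fun w => omega t w i j) z)
    (fun t => d_z k (fun w => ddbar (log_det (omega t)) w i j) z).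
Proof.
have dE : @d_z R n k = wirtinger (- 'i) k by apply/funext => f; exact: d_zE.
move=> Uz; rewrite dE.
pose v1 : Cn R n := (delta_mx 0 k, 0); pose v2 : Cn R n := (0, delta_mx 0 k).
have e1 := evolves_derive_C v1 i j Uz.
have e2 := evolves_derive_C v2 i j Uz.
exact: (evolvesC_Z 2^-1 (evolvesC_D e1 (evolvesC_Z (- 'i) e2))).
Qed.

(** A form [ddbar u] has no torsion, because [d_z k] and [d_z i] commute. *)
Lemma d_z_ddbarC (u : Cn R n -> R) i k b z : smooth_open U u -> U z ->
  d_z k (fun w => ddbar u w i b) z = d_z i (fun w => ddbar u w k b) z.
Proof.
move=> su Uz; have s := csmooth_d_zbar oU b (csmooth_real oU su).
have E l m : d_z l (fun w => ddbar u w m b) z =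
    d_z l (d_z m (d_zbar b (fun w => (u w)%:C))) z.
  by apply: (d_z_eq_on oU l Uz) => w _; rewrite mxE.
by rewrite !E (d_zC oU k i s Uz).
Qed.

Lemma csmooth_ddbar (u : Cn R n -> R) i b : smooth_open U u ->
  csmooth U (fun w => ddbar u w i b).
Proof.
move=> su; have s := csmooth_d_zbar oU b (csmooth_real oU su).
by apply: (csmooth_eq_on oU _ (csmooth_d_z oU i s)) => w _; rewrite mxE.
Qed.

Lemma csmooth_omega_H i b : csmooth U (fun w => @omega_H R n w i b).
Proof.
apply: (csmooth_eq_on oU _ (csmoothZ oU (i == b)%:R csmooth_insq)) => w _.
by rewrite omega_HE mulr_natl.
Qed.

(** The torsion has zero velocity, the Chern-Ricci form being [ddbar] of a
    function, and [ddbar psi] does not contribute to its initial value. *)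
Lemma flow_torsion t z i k b : 0 <= t < T -> U z ->
  d_z k (fun w => omega t w i b) z - d_z i (fun w => omega t w k b) z =
  torsion_H z i k b.
Proof.
move=> tT Uz.
have ev := evolvesC_D (evolves_d_z k i b Uz) (evolvesC_Z (-1) (evolves_d_z i k b Uz)).
have tau0 s : 0 < s < T -> d_z k (fun w => ddbar (log_det (omega s)) w i b) z +
    -1 * d_z i (fun w => ddbar (log_det (omega s)) w k b) z = 0.
  move=> /andP[s0 sT]; have sI : 0 <= s < T by rewrite ltW.
  have sl := smooth_log_det (fun i j => flow_csmooth i j sI)
    (fun z Uz => flow_posdef sI Uz).
  by rewrite (d_z_ddbarC i k b sl Uz) mulN1r subrr.
have := evolvesC0_cst ev tau0 tT; rewrite !mulN1r => ->.
have [_ _ _ i0] := flow.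
have E l m : d_z l (fun w => omega 0 w m b) z =
    d_z l (fun w => omega_H w m b) z + d_z l (fun w => ddbar psi w m b) z.
  rewrite -(d_zD l (csmooth_omega_H m b) (csmooth_ddbar m b spsi) Uz).
  apply: (d_z_eq_on oU l Uz) => w; rewrite inE => Uw.
  by rewrite (i0 w Uw) (omega0E Uw) mxE.
rewrite !E (d_z_ddbarC i k b spsi Uz) -(torsion_omega_H i k b Uz).
by rewrite opprD addrACA subrr addr0.
Qed.

End FlowTorsion.

(** * Orbits of the deck group *)

Section Scaling.
Context {R : realType}.

Lemma bernoulli_exp (c : R) m : 1 <= c -> 1 + m%:R * (c - 1) <= c ^+ m.
Proof.
move=> c1; elim: m => [|m IH]; first by rewrite mul0r addr0 expr0.
have := ler_wpM2l (le_trans ler01 c1) IH; rewrite -exprS; apply: le_trans.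
rewrite -natr1; have m0 : 0 <= m%:R * (c - 1) ^+ 2 by rewrite mulr_ge0 // sqr_ge0.
rewrite -subr_ge0; apply: le_trans m0 _; rewrite le_eqVlt; apply/orP; left.
by apply/eqP; ring.
Qed.

Lemma exp_unbounded (c y : R) : 1 < c -> exists m, y <= c ^+ m.
Proof.
move=> c1; have c10 : 0 < c - 1 by rewrite subr_gt0.
exists (Num.bound (Num.max 0 (y / (c - 1)))).
apply: le_trans (bernoulli_exp _ (ltW c1)).
set M := Num.max _ _; have M0 : 0 <= M by rewrite le_max lexx.
have := archi_boundP M0; move: (Num.bound M)%:R => b Mb.
have yb : y / (c - 1) <= b by apply: le_trans (ltW Mb); rewrite le_max lexx orbT.
by rewrite ler_pdivrMr // in yb; apply: le_trans yb _; rewrite lerDr ler01.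
Qed.

(** Every orbit of the multiplication by [c] on the positive reals meets [1,
    c], in whichever direction the orbit has to be followed. *)
Lemma geometric_annulus (c x : R) : 1 < c -> 0 < x ->
  exists m, 1 <= x * c ^+ m <= c \/ 1 <= x * c^-1 ^+ m <= c.
Proof.
move=> c1 x0; have c0 : 0 < c := lt_trans ltr01 c1.
have [xc|cx] := leP x c.
  have ex : exists m, 1 <= x * c ^+ m.
    have [m hm] := exp_unbounded x^-1 c1; exists m.
    by rewrite mulrC -ler_pdivrMr // div1r.
  case: (ex_minnP ex) => -[|m] h1 hmin.
    by exists 0%N; left; rewrite h1 expr0 mulr1.
  exists m.+1; left; rewrite h1 /= exprS mulrCA ler_piMr ?(ltW c0) //.
  by rewrite leNgt; apply/negP => /ltW/hmin; rewrite ltnn.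
have ex : exists m, x * c^-1 ^+ m <= c.
  have [m hm] := exp_unbounded x c1; exists m.
  rewrite exprVn ler_pdivrMr ?exprn_gt0 //; apply: le_trans hm _.
  by rewrite ler_peMl ?exprn_ge0 // ltW.
case: (ex_minnP ex) => -[|m] h1 hmin.
  by move: h1; rewrite expr0 mulr1 leNgt cx.
exists m.+1; right; rewrite h1 andbT exprSr mulrA ler_pdivlMr // mul1r.
by rewrite leNgt; apply/negP => /ltW/hmin; rewrite ltnn.
Qed.

End Scaling.

Section HopfInvariance.
Context {R : realType} {n : nat}.
Implicit Types (z v w alpha : Cn R n) (i j k b : 'I_n).
Local Notation U := (@punctured R n).

Lemma zcoord_hopf_act alpha z j :
  zcoord (hopf_act alpha z) j = zcoord alpha j * zcoord z j.
Proof. by rewrite {1}/zcoord /hopf_act /= !mxE; apply: complex_ext. Qed.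

Definition cn_inv alpha : Cn R n := cvec (fun j => (zcoord alpha j)^-1).

Lemma zcoord_cvec (e : 'I_n -> R[i]) j : zcoord (cvec e) j = e j.
Proof. by rewrite /zcoord /cvec /= !mxE; case: (e j). Qed.

Lemma hopf_actK alpha z : (forall j, zcoord alpha j != 0) ->
  hopf_act alpha (hopf_act (cn_inv alpha) z) = z.
Proof.
move=> a0; apply: zcoord_inj => j.
by rewrite !zcoord_hopf_act zcoord_cvec mulrA divff ?mul1r.
Qed.

Lemma nsq_hopf_act alpha z (c : R) : (forall j, sqn (zcoord alpha j) = c) ->
  nsq (hopf_act alpha z) = c * nsq z.
Proof.
move=> ac; rewrite /nsq mulr_sumr; apply: eq_bigr => j _.
by rewrite zcoord_hopf_act sqnM ac.
Qed.

Lemma nsq_neq0 z : 0 < nsq z -> z != 0.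
Proof.
move=> h; apply: contraTneq h => ->; rewrite lt_neqAle negb_and; apply/orP; left.
rewrite negbK eq_sym; apply/eqP; rewrite /nsq big1 // => j _.
by rewrite /sqn /zcoord /= !mxE expr0n addr0.
Qed.

(** The factor [c] gained by [nsq] compensates the one lost by the
    coefficients of an invariant form. *)
Lemma trH_hopf_act alpha (c : R) (g : Cn R n -> 'M[R[i]]_n) z :
  (forall j, sqn (zcoord alpha j) = c) -> hopf_invariant_form alpha g -> U z ->
  trH g (hopf_act alpha z) = trH g z.
Proof.
move=> ac ig Uz; rewrite /trH (nsq_hopf_act z ac) rmorphM [c%:C * _]mulrC -mulrA.
congr (_ * _); rewrite /mtr mulr_sumr; apply: eq_bigr => k _.
by rewrite -[RHS](ig z Uz k k) mulJ ac.
Qed.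

Lemma continuous_nsq : continuous (@nsq R n).
Proof.
have [h _] := @csmooth_nsq R n setT openT.
by move=> z; exact: (smooth_continuous h (I : setT z)).
Qed.

(** The annulus is closed, and contained in a product of segments. *)
Lemma compact_annulus (a b : R) : compact [set z : Cn R n | a <= nsq z <= b].
Proof.
(* M is at least 1, so that y ^+ 2 <= M entails that |y| is at most M. *)
pose M := Num.max b 1.
pose Q : set 'rV[R]_n := [set x | forall i, `[- M, M]%classic (x ord0 i)].
have cQ : compact Q.
  by apply: (@rV_compact _ n (fun=> `[- M, M]%classic)) => i; exact: segment_compact.
apply: (@subclosed_compact _ _ (Q `*` Q)); last 2 first.
- exact: compact_setX.
- move=> z /= /andP[_ zb].
  have M1 : 1 <= M by rewrite le_max lexx orbT.
  have sq (y : R) j : y ^+ 2 <= sqn (zcoord z j) -> - M <= y <= M.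
    move=> ys; rewrite -ler_norml -(@ler_pXn2r _ 2) ?nnegrE //; last first.
      by rewrite (le_trans ler01).
    rewrite real_normK ?num_real //; apply: le_trans ys _.
    apply: (@le_trans _ _ (nsq z)).
      rewrite /nsq (bigD1 j) //= lerDl sumr_ge0 // => i _; exact: sqn_ge0.
    apply: le_trans zb _; apply: (@le_trans _ _ M); first by rewrite le_max lexx.
    by rewrite expr2 ler_peMl // (le_trans ler01).
  split => /= i; apply: (sq _ i); rewrite /sqn /zcoord /=.
    by rewrite lerDl sqr_ge0.
  by rewrite lerDr sqr_ge0.
rewrite (_ : [set z | _] = (@nsq R n) @^-1` `[a, b]%classic).
  by apply: preimage_closed => [z _|]; [exact: continuous_nsq | exact: interval_closed].
by rewrite eqEsubset; split => z /=; rewrite in_itv.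
Qed.

End HopfInvariance.

(** * The maximum principle *)

Section MaximumPrinciple.
Context {R : realType} {n : nat}.
Implicit Types (z v w : Cn R n) (i j k b : 'I_n).
Local Notation U := (@punctured R n).
Variables (alpha : Cn R n) (T : R) (psi : Cn R n -> R).
Variables (omega0 : Cn R n -> 'M[R[i]]_n) (omega : R -> Cn R n -> 'M[R[i]]_n).
Hypothesis T0 : 0 < T.
Hypothesis spsi : smooth_open U psi.
Hypothesis omega0E : forall z, U z -> omega0 z = omega_H z + ddbar psi z.
Hypothesis flow : chern_ricci_flow alpha T omega0 omega.
Variable c : R.
Hypothesis sqn_alpha : forall j, sqn (zcoord alpha j) = c.
Hypothesis c0 : 0 < c.
Hypothesis c1 : c != 1.

(** The trace of [omega t] with respect to [omega_H], as a real number. *)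
Definition flow_trace t z : R := nsq z * \sum_k complex.Re (omega t z k k).

Lemma flow_traceE t z : flow_trace t z = complex.Re (trH (omega t) z).
Proof. by rewrite /trH Re_realM /mtr Re_sum. Qed.

Lemma flow_trace_act t z : 0 <= t < T -> U z ->
  flow_trace t (hopf_act alpha z) = flow_trace t z.
Proof.
move=> tT Uz; have [_ hm _ _] := flow; have [_ _ _ ig] := hm t tT.
by rewrite !flow_traceE (trH_hopf_act sqn_alpha ig Uz).
Qed.

(** The existence of deck translates with a prescribed rescaling, in a form
    that composes: powers of the deck transformation and of its inverse are
    reached without being constructed. *)
Definition rescales (d : R) := forall z, U z -> exists w,
  [/\ U w, nsq w = d * nsq z & forall t, 0 <= t < T -> flow_trace t w = flow_trace t z].

Lemma rescales_c : rescales c.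
Proof.
move=> z Uz; exists (hopf_act alpha z).
have E : nsq (hopf_act alpha z) = c * nsq z by exact: nsq_hopf_act.
split => //; last by move=> t tT; exact: flow_trace_act.
by apply: nsq_neq0; rewrite E mulr_gt0 // nsq_gt0.
Qed.

Lemma rescales_cV : rescales c^-1.
Proof.
have a0 j : zcoord alpha j != 0.
  apply/eqP => h; have := sqn_alpha j; rewrite h /sqn /= expr0n addr0 => c00.
  by move: c0; rewrite -c00 ltxx.
have V j : sqn (zcoord (cn_inv alpha) j) = c^-1.
  apply: (mulfI (lt0r_neq0 c0)); rewrite divff ?gt_eqF // -{1}(sqn_alpha j) -sqnM.
  by rewrite zcoord_cvec divff // /sqn /= expr1n expr0n addr0.
move=> z Uz; exists (hopf_act (cn_inv alpha) z).
have E : nsq (hopf_act (cn_inv alpha) z) = c^-1 * nsq z by exact: nsq_hopf_act.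
have Uw : U (hopf_act (cn_inv alpha) z).
  by apply: nsq_neq0; rewrite E mulr_gt0 ?invr_gt0 // nsq_gt0.
by split => // t tT; rewrite -(flow_trace_act tT Uw) hopf_actK.
Qed.

Lemma rescales_exp d m : 0 < d -> rescales d -> rescales (d ^+ m).
Proof.
move=> d0 rd; elim: m => [|m IH] z Uz.
  by exists z; split => //; rewrite expr0 mul1r.
have [w [Uw wE Sw]] := IH z Uz; have [y [Uy yE Sy]] := rd w Uw.
exists y; split => //; first by rewrite yE wE exprS mulrA.
by move=> t tT; rewrite Sy // Sw.
Qed.

(** The deck transformation may contract or expand; [ratio] is the expansion
    factor of it or of its inverse. *)
Definition ratio : R := Num.max c c^-1.

Lemma ratio_gt1 : 1 < ratio.
Proof.
rewrite /ratio lt_max; have [|h|h] := ltgtP 1 c; first by [].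
  by rewrite invf_gt1 // h orbT.
by move: c1; rewrite h eqxx.
Qed.

(** The orbit is followed in the expanding or in the contracting direction,
    according to the size of [nsq z]. *)
Lemma to_annulus z : U z -> exists w, [/\ U w, 1 <= nsq w <= ratio &
  forall t, 0 <= t < T -> flow_trace t w = flow_trace t z].
Proof.
move=> Uz; have r0 : 0 < ratio := lt_trans ltr01 ratio_gt1.
have [r1 r2] : rescales ratio /\ rescales ratio^-1.
  rewrite /ratio; case: (leP c c^-1) => _; rewrite ?invrK;
  by split; (exact: rescales_cV || exact: rescales_c).
have [m [h|h]] := geometric_annulus ratio_gt1 (nsq_gt0 Uz).
  have [w [Uw wE Sw]] := rescales_exp m r0 r1 Uz.
  by exists w; split => //; rewrite wE mulrC.
have rV : 0 < ratio^-1 by rewrite invr_gt0.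
have [w [Uw wE Sw]] := rescales_exp m rV r2 Uz.
by exists w; split => //; rewrite wE mulrC.
Qed.

Let K : set (Cn R n) := [set z | 1 <= nsq z <= ratio].

Let KU z : K z -> U z.
Proof. by move=> /andP[h _]; apply: nsq_neq0; exact: lt_le_trans ltr01 h. Qed.

Lemma smooth_on_within (V : normedModType R) (A B : set V) (f : V -> R) p :
  smooth_on A f -> B `<=` A -> B p -> f @ within B (nbhs p) --> f p.
Proof.
move=> sf BA Bp; have [W [F [oW Wp sF FE]]] := sf p (BA p Bp).
have cF := smooth_continuous sF Wp; rewrite -(FE p (BA p Bp) Wp).
apply/cvgrPdist_lt => e e0; move/cvgrPdist_lt: cF => /(_ e e0) H.
rewrite near_withinE; apply: filterS2 H (open_nbhs_nbhs (conj oW Wp)) => q Hq Wq Bq.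
by rewrite -(FE q (BA q Bq) Wq).
Qed.

Lemma flow_trace_continuous t1 (e : R) : t1 < T ->
  {within `[0, t1]%classic `*` K,
    continuous (fun p : R * Cn R n => flow_trace p.1 p.2 - e * p.1)}.
Proof.
move=> t1T; apply/subspace_continuousP => p Bp.
have [sm _ _ _] := flow.
set A : set (R * Cn R n) := [set p | 0 <= p.1 < T /\ p.2 != 0] in sm.
have sub : `[0, t1]%classic `*` K `<=` A.
  move=> q [/= q1 q2]; move: q1; rewrite in_itv /= => /andP[q0 qt].
  by split; [rewrite q0 (le_lt_trans qt)|exact: KU].
set FF := within _ _.
have cW (h : R * Cn R n -> R) : {for p, continuous h} -> h @ FF --> h p.
  by move=> ch; apply: cvg_trans ch; apply: cvg_app; exact: cvg_within.
have cs : (fun q => \sum_k complex.Re (omega q.1 q.2 k k)) @ FF -->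
    \sum_k complex.Re (omega p.1 p.2 k k).
  elim: (index_enum _) => [|k r IH].
    rewrite big_nil; under eq_fun do rewrite big_nil; exact: cvg_cst.
  rewrite big_cons; under eq_fun do rewrite big_cons.
  have [s1 _] := sm k k.
  exact: (cvgD (smooth_on_within s1 sub Bp) IH).
have cn : (fun q : R * Cn R n => nsq q.2) @ FF --> nsq p.2.
  apply: cW; apply: (continuous_comp (f := snd) (g := @nsq R n)).
    exact: cvg_snd.
  exact: continuous_nsq.
have cf : (fun q : R * Cn R n => q.1) @ FF --> p.1.
  by apply: (cW (fun q => q.1)); exact: cvg_fst.
exact: (cvgB (cvgM cn cs) (cvgM (cvg_cst e) cf)).
Qed.

Lemma is_derive_flow_trace t z : 0 < t < T -> U z ->
  is_derive t 1 (fun s => flow_trace s z)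
    (nsq z * \sum_k complex.Re (ddbar (log_det (omega t)) z k k)).
Proof.
move=> tT Uz; have tI : 0 <= t < T by case/andP: tT => /ltW -> ->.
have [_ _ dm _] := flow.
have ds (r : seq 'I_n) : is_derive t 1 (fun s => \sum_(k <- r) complex.Re (omega s z k k))
    (\sum_(k <- r) complex.Re (ddbar (log_det (omega t)) z k k)).
  elim: r => [|k r IH].
    rewrite big_nil; under eq_fun do rewrite big_nil; exact: is_derive_cst.
  rewrite big_cons; under eq_fun do rewrite big_cons.
  have [h _] := dm t z k k tI Uz.
  rewrite opp_chern_ricci in h.
  exact: (is_deriveD (is_derive_of_within tT h) IH).
exact: (is_deriveZ (nsq z) (ds (index_enum _))).
Qed.

(** Only times before [t] are compared, so this also applies at the final time
    of a compact interval. *)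
Lemma slope_ge_of_left_max (h : R -> R) (t l e : R) : 0 < t -> is_derive t 1 h l ->
  (forall s, 0 <= s <= t -> h s - e * s <= h t - e * t) -> e <= l.
Proof.
move=> t0 [dh lE] mh; rewrite leNgt; apply/negP => le_.
have /cvgr_lt/(_ _ le_) :
    k^-1 *: ((h \o shift t) (k *: 1) - h t) @[k --> 0^'] --> l.
  by rewrite -lE; exact: dh.
move=> /nbhs_ballP[d /= d0 D].
pose k := Num.min d t / 2.
have m0 : 0 < Num.min d t by rewrite lt_min d0 t0.
have k0 : 0 < k by rewrite divr_gt0.
have km : k < Num.min d t by move: m0; rewrite /k; lra.
move: km; rewrite lt_min => /andP[kd kt].
have := D (- k); rewrite -ball_normE /= sub0r opprK gtr0_norm // kd.
rewrite oppr_eq0 => /(_ isT (lt0r_neq0 k0)).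
have -> : - k *: 1 + t = t - k :> R by rewrite [_%:A]mulr1 addrC.
have := mh (t - k); rewrite subr_ge0 (ltW kt) gerBl (ltW k0) => /(_ isT).
have -> : (- k)^-1 *: (h (t - k) - h t) = (h t - h (t - k)) / k.
  by rewrite /GRing.scale /= invrN mulNr -mulrN opprB mulrC.
rewrite ltr_pdivrMr //; move: (h (t - k)) (h t) => a b.
by rewrite mulrBr; lra.
Qed.

(** If the bound failed, the maximum over [0, t1] and the annulus of the trace
    lowered by [e * t], for a small positive [e], would be attained at a
    positive time, where the time derivative would be at least [e]; but it is
    nonpositive there by [ricci_trace_le0]. *)
Lemma flow_trace_bound M : 2 <= M -> (forall z, U z -> flow_trace 0 z <= M) ->
  forall t z, 0 <= t < T -> U z -> flow_trace t z <= M.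
Proof.
move=> M2 M0 t1 z1 t1T Uz1; rewrite leNgt; apply/negP => gtM.
have /andP[t10 t1T'] := t1T.
have [w1 [Uw1 Kw1 Sw1]] := to_annulus Uz1.
rewrite -(Sw1 _ t1T) in gtM.
(* The penalty e * t1 has to stay below the excess of the trace over M. *)
have T1 : 0 < t1 + 1 by rewrite ltr_wpDl.
pose e := (flow_trace t1 w1 - M) / (t1 + 1).
have e0 : 0 < e by rewrite divr_gt0 // subr_gt0.
have eE : e * (t1 + 1) = flow_trace t1 w1 - M by rewrite divfK // gt_eqF.
have [||p pB pmax] := compact_EVT_max _ _ (@flow_trace_continuous t1 e t1T').
- by exists (t1, w1); split => //=; rewrite in_itv /= t10 lexx.
- by apply: compact_setX; [exact: segment_compact | exact: compact_annulus].
move: pB; rewrite inE => -[]; case: p pmax => t0 z0 /= pmax.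
rewrite in_itv /= => /andP[t00 t0t1] Kz0.
have Uz0 := KU Kz0.
have t0T : 0 <= t0 < T by rewrite t00 (le_lt_trans t0t1).
have big : M < flow_trace t0 z0 - e * t0.
  have P1 : (t1, w1) \in `[0, t1]%classic `*` K.
    by rewrite inE; split => //=; rewrite in_itv /= t10 lexx.
  apply: lt_le_trans (pmax _ P1); rewrite /= -subr_gt0.
  have -> : flow_trace t1 w1 - e * t1 - M = e; last exact: e0.
  by rewrite addrAC -eE; ring.
have St0 : M < flow_trace t0 z0.
  by apply: lt_le_trans big _; rewrite gerBl mulr_ge0 // ltW.
have t0pos : 0 < t0.
  rewrite lt_neqAle t00 andbT; apply/eqP => t0E.
  by move: St0; rewrite -t0E ltNge (M0 _ Uz0).
have t0T' : 0 < t0 < T by rewrite t0pos; case/andP: t0T.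
have maxz z : U z -> flow_trace t0 z <= flow_trace t0 z0.
  move=> Uz; have [w [Uw Kw Sw]] := to_annulus Uz; rewrite -(Sw _ t0T).
  have := pmax (t0, w); rewrite inE /= lerD2r; apply.
  by split => //=; rewrite in_itv /= t00.
have le0 : \sum_k complex.Re (ddbar (log_det (omega t0)) z0 k k) <= 0.
  apply: (ricci_trace_le0 (fun i j => flow_csmooth flow i j t0T)
    (fun z Uz => flow_posdef flow t0T Uz)
    (fun z Uz i k b => flow_torsion T0 spsi omega0E flow i k b t0T Uz) Uz0).
    by move=> z Uz; rewrite -!flow_traceE; exact: maxz.
  by rewrite -flow_traceE (le_trans M2) // ltW.
have := slope_ge_of_left_max t0pos (is_derive_flow_trace t0T' Uz0) (e := e).
rewrite leNgt (le_lt_trans _ e0); last by rewrite mulr_ge0_le0 // nsq_ge0.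
move=> H; apply: notF; apply: H => s /andP[s0 st].
have := pmax (s, z0); rewrite inE /=; apply.
by split => //=; rewrite in_itv /= s0 (le_trans st).
Qed.

(** The initial trace is continuous and invariant, so its supremum is attained
    on the annulus. *)
Lemma flow_trace0_bounded : exists M, forall z, U z -> flow_trace 0 z <= M.
Proof.
have [|/forallNP N] := pselect (exists z : Cn R n, U z); last first.
  by exists 0 => z /N.
move=> [z1 Uz1]; have [w1 [Uw1 Kw1 Sw1]] := to_annulus Uz1.
have [||p pB pmax] := compact_EVT_max _ _ (@flow_trace_continuous 0 0 T0).
- by exists (0, w1); split => //=; rewrite in_itv /= lexx.
- by apply: compact_setX; [exact: segment_compact | exact: compact_annulus].
exists (flow_trace p.1 p.2) => z Uz; have [w [Uw Kw Sw]] := to_annulus Uz.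
have I0 : 0 <= (0 : R) < T by rewrite lexx.
rewrite -(Sw _ I0); have := pmax (0, w); rewrite inE /= !mul0r !subr0; apply.
by split => //=; rewrite in_itv /= lexx.
Qed.

(** A Hermitian form is bounded by its trace, and the trace of [omega t] is
    [flow_trace] divided by [nsq]. *)
Lemma flow_form_le M t z : 0 <= t < T -> U z -> flow_trace t z <= M ->
  form_le (omega t z) (M%:C *: omega_H z).
Proof.
move=> tT Uz SM; have pz := flow_posdef flow tT Uz; have [hz pos] := pz.
have Np := nsq_gt0 Uz.
have E p q : (M%:C *: omega_H z - omega t z) p q =
    M%:C * (insq z *+ (p == q)) - omega t z p q.
  by rewrite mxE [X in X + _]mxE [X in _ + X]mxE omega_HE.
split.
  rewrite hermsymmxE; apply/eqP/matrixP => i j.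
  rewrite ctrE !E rmorphB rmorphM rmorphMn /= insqJ (conjc_real M : (M%:C)^*%R = _).
  rewrite [j == i]eq_sym; congr (_ - _).
  by move: hz; rewrite hermsymmxE => /eqP/matrixP/(_ i j); rewrite ctrE.
move=> v.
have -> : \sum_i \sum_j (M%:C *: omega_H z - omega t z) i j * v 0 i * (v 0 j)^*%R =
    (M * (nsq z)^-1 * \sum_i sqn (v 0 i))%:C - hquad (omega t z) v.
  have RS : (\sum_i sqn (v 0 i))%:C = \sum_i v 0 i * (v 0 i)^*%R.
    by rewrite rmorph_sum; apply: eq_bigr => i _; rewrite mulJ.
  have RM (x y : R) : (x * y)%:C = x%:C * y%:C by exact: rmorphM.
  rewrite /hquad RM RS mulr_sumr -sumrB; apply: eq_bigr => i _.
  rewrite -(sum_delta (fun j => (M * (nsq z)^-1)%:C * (v 0 i * (v 0 j)^*%R)) i).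
  rewrite -sumrB; apply: eq_bigr => j _; rewrite E /insq RM.
  by rewrite [j == i]eq_sym -mulr_natl; ring.
have Im0 : complex.Im (hquad (omega t z) v) = 0.
  have [->|v0] := eqVneq v 0.
    rewrite /hquad big1 // => i _; rewrite big1 // => j _.
    by rewrite !mxE mulr0 mul0r.
  by apply: ger0_Im; apply: ltW; exact: pos.
rewrite lecE; case: (hquad _ _) Im0 (posdef_le_trace v pz) => a b /= -> le_a.
rewrite oppr0 addr0 eqxx /= subr_ge0; apply: le_trans le_a _.
apply: ler_wpM2r; first by apply: sumr_ge0 => i _; exact: sqn_ge0.
rewrite ler_pdivlMr // mulrC; apply: le_trans SM.
by rewrite /flow_trace /mxtrace Re_sum.
Qed.

End MaximumPrinciple.

Theorem proposition1p9 (R : realType) (n : nat) (alpha : Cn R n)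
    (psi : Cn R n -> R) (omega0 : Cn R n -> 'M[R[i]]_n)
    (omega : R -> Cn R n -> 'M[R[i]]_n) :
  (2 <= n)%N ->
  alpha != 0 ->
  (forall j k, `|zcoord alpha j| = `|zcoord alpha k|) ->
  (forall j, `|zcoord alpha j| != 1) ->
  hopf_smooth_function alpha psi ->
  (forall z : Cn R n, z != 0 -> omega0 z = omega_H z + ddbar psi z) ->
  hopf_hermitian_metric alpha omega0 ->
  chern_ricci_flow alpha (n%:R^-1) omega0 omega ->
  exists C : R, forall t : R, 0 <= t < n%:R^-1 ->
    forall z : Cn R n, z != 0 -> form_le (omega t z) (C%:C *: omega_H z).
Proof.
move=> n2 a0 aE a1 [spsi _] omega0E _ flow.
have T0 : 0 < n%:R^-1 :> R by rewrite invr_gt0 ltr0n (leq_trans _ n2).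
(* The coordinates are indexed by a nonempty type, so alpha has a first one. *)
case: n n2 alpha psi omega0 omega a0 aE a1 spsi omega0E flow T0 => // m _.
move=> alpha psi omega0 omega a0 aE a1 spsi omega0E flow T0.
pose c := sqn (zcoord alpha 0).
have cE j : `|zcoord alpha j| ^+ 2 = (sqn (zcoord alpha j))%:C by rewrite normCK mulJ.
have ac j : sqn (zcoord alpha j) = c.
  by apply: complexI; rewrite -!cE (aE j 0).
have c0 : 0 < c.
  have := nsq_gt0 a0; rewrite /nsq (eq_bigr _ (fun j _ => ac j)) sumr_const.
  by rewrite card_ord pmulrn_lgt0.
have c1 : c != 1.
  apply: contra (a1 0) => /eqP ce; have := cE 0; rewrite -/c ce => /eqP.
  by rewrite sqrp_eq1.
have [M0 hM0] := flow_trace0_bounded T0 flow ac c0 c1.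
exists (Num.max 2 M0) => t tT z Uz.
apply: (flow_form_le flow tT Uz).
apply: (flow_trace_bound T0 spsi omega0E flow ac c0 c1) => //; first by rewrite le_max lexx.
by move=> w Uw; apply: le_trans (hM0 w Uw) _; rewrite le_max lexx orbT.
Qed.
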